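(* Let $d\ge2$, let $M^1$ be $S^1$ or $[0,2\pi]$, and let $k(x,u,y,v)=\rho(|x-y|^2)\,\gamma(u\cdot v)$ be a kernel on $\mathbb{R}^d\times S^{d-1}$ as described in the context, with associated varifold pseudo-distance $d^{\mathrm{Var}}$. Assume that $\rho$ and $\gamma$ are $C^1$-functions, that $\rho$ is $C_0$-universal, that $\gamma(1)>0$, and that $\gamma(-t)\neq\gamma(t)$ for all $t\neq0$. If $c_1,c_2\in\mathrm{Imm}(M^1,\mathbb{R}^d)$ are two immersions with a finite number of transverse self-intersections, then $d^{\mathrm{Var}}(c_1,c_2)=0$ if and only if the two curves coincide in $B_i^+(M^1,\mathbb{R}^d)=\mathrm{Imm}(M^1,\mathbb{R}^d)/\mathrm{Diff}^+(M^1)$.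
   Context: $S^1=\mathbb{R}/2\pi\mathbb{Z}$. $\mathrm{Imm}(M^1,\mathbb{R}^d)=\{c\in C^\infty(M^1,\mathbb{R}^d): c'(\theta)\ne0\ \forall\theta\in M^1\}$. $\mathrm{Diff}(M^1)$ is the group of smooth diffeomorphisms of $M^1$, and $\mathrm{Diff}^+(M^1)=\{\varphi\in\mathrm{Diff}(M^1):\varphi'(\theta)>0\ \forall\theta\}$, acting on immersions by $c\mapsto c\circ\varphi$; two immersions coincide in $B_i^+(M^1,\mathbb{R}^d)$ iff $c_2=c_1\circ\varphi$ for some $\varphi\in\mathrm{Diff}^+(M^1)$. An immersion with a finite number of transverse self-intersections is one whose self-intersections (points of $\mathbb{R}^d$ having more than one preimage) are finite in number and such that at each self-intersection point the tangent vectors $c'(\theta)$ at distinct preimages $\theta$ are pairwise non-collinear. Kernel and metric: $C_0(X)$ denotes continuous functions on $X$ vanishing at infinity. The function $\rho$ defines a continuous, positive radial basis function (i.e. $(x,y)\mapsto\rho(|x-y|^2)$ is a positive definite kernel on $\mathbb{R}^d$) with $\rho(t)\to0$ as $t\to\infty$, and $\gamma:[-1,1]\to\mathbb{R}$ defines a continuous positive definite zonal kernel $(u,v)\mapsto\gamma(u\cdot v)$ on $S^{d-1}$. The kernel $k$ on $\mathbb{R}^d\times S^{d-1}$ is positive definite and generates a reproducing kernel Hilbert space $\mathcal{H}$ continuously embedded in $C_0(\mathbb{R}^d\times S^{d-1})$. The kernel $\rho$ is $C_0$-universal if the reproducing kernel Hilbert space of $(x,y)\mapsto\rho(|x-y|^2)$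 is dense in $C_0(\mathbb{R}^d,\mathbb{R})$. For $c\in\mathrm{Imm}(M^1,\mathbb{R}^d)$ let $\mu_c\in C_0(\mathbb{R}^d\times S^{d-1})^*$ be the oriented varifold $\mu_c(\omega)=\int_{M^1}\omega\big(c(\theta),\tfrac{c'(\theta)}{|c'(\theta)|}\big)|c'(\theta)|\,\mathrm{d}\theta$, viewed in $\mathcal{H}^*$ by restriction. Let $\langle\cdot,\cdot\rangle_{\mathrm{Var}}$ be the dual inner product on $\mathcal{H}^*$ with norm $\|\cdot\|_{\mathrm{Var}}$. Then $d^{\mathrm{Var}}(c_1,c_2)=\|\mu_{c_1}-\mu_{c_2}\|_{\mathrm{Var}}$, where explicitly $$\langle\mu_{c_1},\mu_{c_2}\rangle_{\mathrm{Var}}=\iint_{M^1\times M^1}\rho(|c_1(\theta_1)-c_2(\theta_2)|^2)\,\gamma\!\left(\tfrac{c_1'(\theta_1)}{|c_1'(\theta_1)|}\cdot\tfrac{c_2'(\theta_2)}{|c_2'(\theta_2)|}\right)|c_1'(\theta_1)|\,|c_2'(\theta_2)|\,\mathrm{d}\theta_1\mathrm{d}\theta_2 .$$ *)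

(* Defs.v *)
From HB Require Import structures.
From mathcomp Require Import all_boot all_order all_algebra.
From mathcomp Require Import all_classical all_reals all_analysis.

Set Implicit Arguments.
Unset Strict Implicit.
Unset Printing Implicit Defensive.

Import Order.TTheory GRing.Theory Num.Theory.
Import numFieldNormedType.Exports.

Local Open Scope ring_scope.
Local Open Scope classical_set_scope.

(* The library norm `|x| on 'rV[R]_d is the sup norm, so the Euclidean
   structure is introduced separately; the topology is the same. *)
Definition dot (R : realType) (d : nat) (u v : 'rV[R]_d) : R :=
  \sum_(i < d) u 0 i * v 0 i.

Definition enorm (R : realType) (d : nat) (u : 'rV[R]_d) : R :=
  Num.sqrt (dot u u).

Definition sphere (R : realType) (d : nat) : set 'rV[R]_d :=
  [set u | enorm u = 1].

(* R^d x S^(d-1), the sphere carrying the topology induced by R^d. *)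
Notation phase R d := ('rV[R]_d * set_type (@sphere R d))%type.

Definition positive_definite (R : realType) (X : Type) (K : X -> X -> R) :=
  (forall x y, K x y = K y x) /\
  forall (n : nat) (x : 'I_n -> X) (a : 'I_n -> R),
    0 <= \sum_(i < n) \sum_(j < n) a i * a j * K (x i) (x j).

Definition C0 (R : realType) (X : topologicalType) : set (X -> R) :=
  [set f | continuous f /\
    forall e : R, 0 < e ->
      exists2 A : set X, compact A & forall x, ~ A x -> `|f x| < e].

(* The reproducing kernel Hilbert space of K, which is unique: a Hilbert space
   of functions on X that contains the sections K x and in which pairing with
   K x is evaluation at x.  The values of rkhs_ip outside rkhs_space are
   irrelevant. *)
Record rkhs (R : realType) (X : Type) (K : X -> X -> R) := Rkhs {
  rkhs_space : set (X -> R) ;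
  rkhs_ip : (X -> R) -> (X -> R) -> R ;
  rkhs_space0 : rkhs_space (fun=> 0) ;
  rkhs_spaceP : forall (a : R) f g, rkhs_space f -> rkhs_space g ->
    rkhs_space (a \*o f \+ g) ;
  rkhs_ipC : forall f g, rkhs_space f -> rkhs_space g ->
    rkhs_ip f g = rkhs_ip g f ;
  rkhs_ipP : forall (a : R) f g h,
    rkhs_space f -> rkhs_space g -> rkhs_space h ->
    rkhs_ip (a \*o f \+ g) h = a * rkhs_ip f h + rkhs_ip g h ;
  rkhs_ip_ge0 : forall f, rkhs_space f -> 0 <= rkhs_ip f f ;
  rkhs_ip_eq0 : forall f, rkhs_space f -> rkhs_ip f f = 0 -> f = fun=> 0 ;
  rkhs_complete : forall u : nat -> X -> R, (forall n, rkhs_space (u n)) ->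
    (forall e : R, 0 < e -> exists N : nat, forall m n : nat,
      (N <= m)%N -> (N <= n)%N -> rkhs_ip (u m \- u n) (u m \- u n) < e) ->
    exists2 f, rkhs_space f &
      rkhs_ip (u n \- f) (u n \- f) @[n --> \oo] --> (0 : R) ;
  rkhs_section : forall x, rkhs_space (K x) ;
  rkhs_reproducing : forall f x, rkhs_space f -> rkhs_ip f (K x) = f x
}.

Definition rkhs_norm (R : realType) (X : Type) (K : X -> X -> R) (H : rkhs K)
  (f : X -> R) : R := Num.sqrt (rkhs_ip H f f).

(* Norm on the dual of H; it is the norm of the dual inner product. *)
Definition rkhs_dual_norm (R : realType) (X : Type) (K : X -> X -> R)
    (H : rkhs K) (l : (X -> R) -> R) : \bar R :=
  ereal_sup [set (`|l w|)%:E | w in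
    [set w | rkhs_space H w /\ rkhs_norm H w <= 1]].

Definition embedded_in_C0 (R : realType) (X : topologicalType)
    (K : X -> X -> R) (H : rkhs K) :=
  rkhs_space H `<=` @C0 R X /\
  exists C : R, forall w x, rkhs_space H w -> `|w x| <= C * rkhs_norm H w.

(* Density is with respect to the uniform norm. *)
Definition dense_in_C0 (R : realType) (X : topologicalType)
    (K : X -> X -> R) (H : rkhs K) :=
  rkhs_space H `<=` @C0 R X /\
  forall f, @C0 R X f -> forall e : R, 0 < e ->
    exists2 w, rkhs_space H w & forall x, `|f x - w x| <= e.

Definition radial_kernel (R : realType) (d : nat) (rho : R -> R) :
    'rV[R]_d -> 'rV[R]_d -> R :=
  fun x y => rho (enorm (x - y) ^+ 2).

Definition zonal_kernel (R : realType) (d : nat) (gamma : R -> R) :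
    set_type (@sphere R d) -> set_type (@sphere R d) -> R :=
  fun u v => gamma (dot (val u) (val v)).

Definition varifold_kernel (R : realType) (d : nat) (rho gamma : R -> R) :
    phase R d -> phase R d -> R :=
  fun p q => radial_kernel rho p.1 q.1 * zonal_kernel gamma p.2 q.2.

(* Only the values of rho on [0, +oo[ and of gamma on [-1, 1] matter. *)
Definition radial_basis_function (R : realType) (d : nat) (rho : R -> R) :=
  [/\ {within `[0, +oo[, continuous rho},
      positive_definite (@radial_kernel R d rho) &
      rho t @[t --> +oo] --> (0 : R)].

Definition zonal_function (R : realType) (d : nat) (gamma : R -> R) :=
  {within `[(-1), 1], continuous gamma} /\
  positive_definite (@zonal_kernel R d gamma).

Definition C0_universal (R : realType) (d : nat) (rho : R -> R) :=
  exists H : rkhs (@radial_kernel R d rho), dense_in_C0 H.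

Definition C1_on (R : realType) (A : set R) (f : R -> R) :=
  exists g : R -> R, [/\ (forall x, derivable g x 1), continuous (g^`())
    & forall x, A x -> f x = g x].

(* f is infinitely differentiable on a neighbourhood of A. *)
Definition smooth_on (R : realType) (V : normedModType R) (A : set R)
    (f : R -> V) :=
  exists U : set R, [/\ open U, A `<=` U &
    forall (n : nat) x, U x -> derivable (f^`(n)) x 1].

(* S^1 = R / 2 pi Z and [0, 2 pi]. *)
Variant manifold1 := circle | segment.

(* A map on M is represented by a function on R: a 2 pi-periodic one if M is
   the circle; if M is the segment, any extension of the map that is smooth
   near [0, 2 pi], only the restriction to [0, 2 pi] being relevant.
   [params M] is the set of meaningful parameters, while [points M] contains
   exactly one parameter of each point of M. *)
Definition params (R : realType) (M : manifold1) : set R :=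
  match M with circle => setT | segment => `[0, 2 * pi] end.

Definition points (R : realType) (M : manifold1) : set R :=
  match M with circle => `[0, 2 * pi[ | segment => `[0, 2 * pi] end.

Definition smooth_curve (R : realType) (d : nat) (M : manifold1)
    (c : R -> 'rV[R]_d) :=
  smooth_on (params M) c /\
  match M with
  | circle => forall t, c (t + 2 * pi) = c t
  | segment => True
  end.

Definition immersion (R : realType) (d : nat) (M : manifold1)
    (c : R -> 'rV[R]_d) :=
  smooth_curve M c /\ forall t, params M t -> c^`() t <> 0.

(* Smooth self-maps of M; those of the circle are given by their lifts to R. *)
Definition smooth_self_map (R : realType) (M : manifold1) (phi : R -> R) :=
  smooth_on (params M) phi /\
  match M with
  | circle => forall t, exists k : int,
      phi (t + 2 * pi) = phi t + 2 * pi * k%:~R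
  | segment => forall t, params M t -> params M (phi t)
  end.

Definition diffeo (R : realType) (M : manifold1) (phi : R -> R) :=
  smooth_self_map M phi /\
  exists2 psi : R -> R, smooth_self_map M psi &
    forall t, params M t -> psi (phi t) = t /\ phi (psi t) = t.

Definition diffeo_plus (R : realType) (M : manifold1) (phi : R -> R) :=
  diffeo M phi /\ forall t, params M t -> 0 < phi^`() t.

Definition coincide_mod_diffeo_plus (R : realType) (d : nat) (M : manifold1)
    (c1 c2 : R -> 'rV[R]_d) :=
  exists2 phi : R -> R, diffeo_plus M phi &
    forall t, params M t -> c2 t = c1 (phi t).

Definition noncollinear (R : realType) (d : nat) (u v : 'rV[R]_d) :=
  forall a b : R, a *: u + b *: v = 0 -> a = 0 /\ b = 0.

Definition finite_transverse_self_intersections (R : realType) (d : nat)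
    (M : manifold1) (c : R -> 'rV[R]_d) :=
  finite_set [set x | exists s t,
    [/\ points M s, points M t, s <> t, c s = x & c t = x]] /\
  forall s t, points M s -> points M t -> s <> t -> c s = c t ->
    noncollinear (derive1 c s) (derive1 c t).

(* The oriented varifold mu_c.  The unit tangent of an immersion always lies
   on the sphere, so the value 0 for a zero velocity is never used. *)
Definition varifold (R : realType) (d : nat) (M : manifold1)
    (c : R -> 'rV[R]_d) (w : phase R d -> R) : R :=
  \int[lebesgue_measure]_(t in points M)
    (oapp (fun u : set_type (@sphere R d) => w (c t, u)) 0
       (insub ((enorm (derive1 c t))^-1 *: derive1 c t)) * enorm (derive1 c t)).

(* As in the definition of H^* as a dual space, the two varifolds are compared
   as functionals on H. *)
Definition dVar (R : realType) (d : nat) (rho gamma : R -> R)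
    (H : rkhs (@varifold_kernel R d rho gamma)) (M : manifold1)
    (c1 c2 : R -> 'rV[R]_d) : \bar R :=
  rkhs_dual_norm H (fun w => varifold M c1 w - varifold M c2 w).

(* Main.v *)
Require Import Defs.
From HB Require Import structures.
From mathcomp Require Import all_boot all_order all_algebra.
From mathcomp Require Import all_classical all_reals all_analysis.
From mathcomp Require Import ring lra.

(** If c2 = c1 o phi with phi an increasing diffeomorphism, the change of variable
    t -> phi t turns the integral defining one varifold into that of the other
    (varifold_reparametrization).

    Conversely, let the distance vanish.  Then the varifolds agree on the sections
    of the kernel, and the density of the space of the radial kernel makes them
    agree on all products of a test function of the position and a section
    gamma (u . _) of the zonal kernel (dVar0_test_function).

    Let x be a point with a single tangent direction sigma on the second curve and
    at most one, tau, on the first.  Test functions concentrating at x compare the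
    masses of the two curves near x, weighted by gamma (u . sigma) and
    gamma (u . tau); letting u vary forces x to lie on the first curve as well and
    tau = sigma (tangents_agree).  This applies to all but finitely many points,
    since the self-intersections are finite in number; by compactness, every
    parameter of one curve is therefore matched with a parameter of the other
    having the same position and direction (match_exists).  The match is unique,
    because the tangents at a self-intersection are not collinear (points_inj).

    A unique match with a closed graph is continuous.  Differentiating
    P1 (phi s) = P2 s along the common tangent shows that it preserves arc length
    up to a constant (matched_arc_length); comparing lengths in both directions,
    the constant is zero if the two origins are matched.  Hence the match is
    L1^-1 o L2, with L1 and L2 the arc lengths from the origin
    (matched_reparametrization).  On the circle the origins are matched after a
    rotation, and the formula gives a lift to the line; on the segment it extends
    the match beyond the end points.  Smoothness follows from the differential
    equation phi' = |c2'| / |c1' (phi)| (smooth_change_of_speed). *)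

Set Implicit Arguments.
Unset Strict Implicit.
Unset Printing Implicit Defensive.

Import Order.TTheory GRing.Theory Num.Theory.
Import numFieldNormedType.Exports.

Local Open Scope ring_scope.
Local Open Scope classical_set_scope.

(** * Reproducing kernel Hilbert spaces *)

Section Rkhs.
Context (R : realType) (X : Type) (K : X -> X -> R) (H : rkhs K).
Notation V := (rkhs_space H).
Notation ip := (rkhs_ip H).
Implicit Types (f g h : X -> R) (a : R).

Lemma rkhs_spaceZ a f : V f -> V (a \*o f).
Proof.
move=> Vf; rewrite (_ : a \*o f = a \*o f \+ fun=> 0).
  by apply: rkhs_spaceP => //; exact: rkhs_space0.
by apply/funext => x /=; rewrite addr0.
Qed.

Lemma rkhs_spaceD f g : V f -> V g -> V (f \+ g).
Proof.
move=> Vf Vg; rewrite (_ : f \+ g = 1 \*o f \+ g); first exact: rkhs_spaceP.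
by apply/funext => x /=; rewrite mul1r.
Qed.

Lemma rkhs_spaceB f g : V f -> V g -> V (f \- g).
Proof.
move=> Vf Vg; rewrite (_ : f \- g = (-1) \*o g \+ f); first exact: rkhs_spaceP.
by apply/funext => x /=; rewrite mulN1r addrC.
Qed.

Lemma rkhs_ip0l h : V h -> ip (fun=> 0) h = 0.
Proof.
move=> Vh; have V0 := rkhs_space0 H.
have := rkhs_ipP (-1) V0 V0 Vh.
rewrite (_ : (-1) \*o (fun=> 0) \+ (fun=> 0) = fun=> 0); first by move=> ->; ring.
by apply/funext => x /=; rewrite mulr0 addr0.
Qed.

Lemma rkhs_ipZl a f h : V f -> V h -> ip (a \*o f) h = a * ip f h.
Proof.
move=> Vf Vh; rewrite (_ : a \*o f = a \*o f \+ fun=> 0); last first.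
  by apply/funext => x /=; rewrite addr0.
by rewrite (rkhs_ipP _ Vf (rkhs_space0 H) Vh) rkhs_ip0l// addr0.
Qed.

Lemma rkhs_sqrZD a f g : V f -> V g ->
  ip (a \*o f \+ g) (a \*o f \+ g) =
  a ^+ 2 * ip f f + 2 * a * ip f g + ip g g.
Proof.
move=> Vf Vg; have Vfg := rkhs_spaceP a Vf Vg.
rewrite (rkhs_ipP _ Vf Vg Vfg) (rkhs_ipC Vf Vfg) (rkhs_ipC Vg Vfg).
rewrite (rkhs_ipP _ Vf Vg Vf) (rkhs_ipP _ Vf Vg Vg) (rkhs_ipC Vg Vf).
ring.
Qed.

Lemma rkhs_cauchy_schwarz f g : V f -> V g -> ip f g ^+ 2 <= ip f f * ip g g.
Proof.
move=> Vf Vg; have [f0|f0] := eqVneq (ip f f) 0.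
  rewrite f0 mul0r (rkhs_ip_eq0 Vf f0) rkhs_ip0l//; lra.
have fgt0 : 0 < ip f f by rewrite lt_neqAle eq_sym f0 rkhs_ip_ge0.
have := rkhs_ip_ge0 (rkhs_spaceP (- ip f g / ip f f) Vf Vg).
rewrite rkhs_sqrZD// => /(mulr_ge0 (ltW fgt0)).
rewrite -(subr_ge0 (_ ^+ 2)).
move: (ip f f) (ip f g) (ip g g) f0 => x y z x0.
by rewrite (_ : x * (_ + _) = x * z - y ^+ 2)//; field.
Qed.

Lemma rkhs_eval_sqr_le f x : V f -> f x ^+ 2 <= K x x * ip f f.
Proof.
move=> Vf; have Vx := rkhs_section H x.
rewrite -(rkhs_reproducing x Vf) -(rkhs_reproducing x Vx) mulrC.
exact: rkhs_cauchy_schwarz.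
Qed.

Lemma rkhs_norm_ge0 f : 0 <= rkhs_norm H f.
Proof. exact: sqrtr_ge0. Qed.

Lemma rkhs_norm_sqr f : V f -> rkhs_norm H f ^+ 2 = ip f f.
Proof. by move=> Vf; rewrite sqr_sqrtr// rkhs_ip_ge0. Qed.

Lemma rkhs_normZ a f : V f -> rkhs_norm H (a \*o f) = `|a| * rkhs_norm H f.
Proof.
move=> Vf; rewrite /rkhs_norm rkhs_ipZl ?(rkhs_ipC Vf)//; last exact: rkhs_spaceZ.
  by rewrite rkhs_ipZl// mulrA -expr2 sqrtrM ?sqr_ge0// sqrtr_sqr.
exact: rkhs_spaceZ.
Qed.

(** By Riesz' theorem the functional is the inner product with some h, and
    h x = <h, K x> = l (K x) = 0.  The proof follows that of the theorem: if l
    takes the value 1, elements w_n of nearly minimal norm among those with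
    value 1 form a Cauchy sequence by the parallelogram law and are nearly
    orthogonal to the sections, since these can be added to w_n freely; so the
    w_n tend to 0, against boundedness. *)
Lemma rkhs_functional_eq0 (l : (X -> R) -> R) (C : R) :
  (forall a f g, V f -> V g -> l (a \*o f \+ g) = a * l f + l g) ->
  (forall f, V f -> `|l f| <= C * rkhs_norm H f) ->
  (forall x, l (K x) = 0) ->
  forall f, V f -> l f = 0.
Proof.
move=> lP lC lK f0 Vf0; apply/eqP/negPn/negP => lf0.
have lZ a f : V f -> l (a \*o f) = a * l f.
  move=> Vf; have V0 := rkhs_space0 H.
  have l0 : l (fun=> 0) = 0.
    have := lP (-1) _ _ V0 V0.
    rewrite (_ : (-1) \*o (fun=> 0) \+ (fun=> 0) = fun=> 0).
      by move=> ->; ring.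
    by apply/funext => x /=; rewrite mulr0 addr0.
  rewrite (_ : a \*o f = a \*o f \+ fun=> 0) ?lP// ?l0 ?addr0//.
  by apply/funext => x /=; rewrite addr0.
pose A := [set w | V w /\ l w = 1].
pose S := [set ip w w | w in A].
have A0 : A ((l f0)^-1 \*o f0).
  by split; [exact: rkhs_spaceZ|rewrite lZ// mulVf].
have hS : has_inf S.
  split; first by exists (ip ((l f0)^-1 \*o f0) ((l f0)^-1 \*o f0)); exists ((l f0)^-1 \*o f0).
  by exists 0 => _ [w [Vw _] <-]; exact: rkhs_ip_ge0.
pose m := inf S.
have mA w : A w -> m <= ip w w.
  by move=> Aw; apply: ge_inf; [exact: hS.2|exists w].
have [w wP] : {w : nat -> X -> R &
    forall n, A (w n) /\ ip (w n) (w n) < m + n.+1%:R^-1}.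
  apply: (@choice nat (X -> R) (fun n w => A w /\ ip w w < m + n.+1%:R^-1)) => n.
  have n0 : 0 < n.+1%:R^-1 :> R by rewrite invr_gt0 ltr0n.
  have [_ [v Av <-] vlt] := inf_adherent n0 hS.
  by exists v.
have wA n : A (w n) := (wP n).1.
have wV n : V (w n) := (wA n).1.
have close n p : ip (w n \- w p) (w n \- w p) <= 2 * n.+1%:R^-1 + 2 * p.+1%:R^-1.
  have Amid : A (2^-1 \*o (w n \+ w p)).
    split; first by apply: rkhs_spaceZ; exact: rkhs_spaceD.
    rewrite lZ; last exact: rkhs_spaceD.
    rewrite (_ : w n \+ w p = 1 \*o w n \+ w p); last first.
      by apply/funext => x /=; rewrite mul1r.
    by rewrite lP// (wA n).2 (wA p).2 mul1r mulVf.
  have := mA _ Amid.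
  rewrite (_ : 2^-1 \*o (w n \+ w p) = 2^-1 \*o w n \+ (2^-1 \*o w p)); last first.
    by apply/funext => x /=; rewrite mulrDr.
  have Vp2 := rkhs_spaceZ (2^-1) (wV p).
  rewrite rkhs_sqrZD//.
  rewrite (rkhs_ipC (wV n) Vp2) (rkhs_ipZl _ (wV p) (wV n)) (rkhs_ipZl _ (wV p) Vp2).
  rewrite (rkhs_ipC (wV p) Vp2) (rkhs_ipZl _ (wV p) (wV p)).
  rewrite (_ : w n \- w p = (-1) \*o w p \+ w n); last first.
    by apply/funext => x /=; rewrite mulN1r addrC.
  rewrite rkhs_sqrZD//.
  have := (wP n).2; have := (wP p).2.
  move: (ip (w p) (w n)) (ip (w n) (w n)) (ip (w p) (w p)) => c a b.
  move: (n.+1%:R^-1) (p.+1%:R^-1) => i j.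
  lra.
have smalln (e : R) : 0 < e -> exists N, forall n, (N <= n)%N -> n.+1%:R^-1 < e.
  move=> e0; have := near_infty_natSinv_lt (PosNum e0).
  by case=> N _ NP; exists N => n Nn; exact: NP.
have cauchy (e : R) : 0 < e -> exists N : nat, forall m n : nat,
      (N <= m)%N -> (N <= n)%N -> ip (w m \- w n) (w m \- w n) < e.
  move=> e0; have [N NP] := smalln (e / 4) ltac:(lra).
  exists N => p n Np Nn; apply: le_lt_trans (close p n) _.
  have := NP _ Np; have := NP _ Nn.
  by move: (p.+1%:R^-1) (n.+1%:R^-1) => i j; lra.
have [z Vz wz] := rkhs_complete wV cauchy.
have wx0 x (e : R) : 0 < e -> exists N, forall n, (N <= n)%N -> `|w n x| <= e.
  move=> e0.
  have Vx := rkhs_section H x.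
  have k0 : 0 <= K x x.
    by rewrite -(rkhs_reproducing x Vx) rkhs_ip_ge0.
  (* s balances the two errors in 2 s |w n x| <= s^2 K x x + 1 / n.+1 *)
  pose s := e / (K x x + 1).
  have s0 : 0 < s by rewrite divr_gt0//; lra.
  have sk : s * K x x <= e.
    rewrite /s mulrAC ler_pdivrMr; last lra.
    by rewrite ler_pM2l//; lra.
  have [N NP] := smalln (e * s) ltac:(exact: mulr_gt0).
  exists N => n /NP nes.
  have key a : 2 * a * w n x + a ^+ 2 * K x x + n.+1%:R^-1 >= 0.
    have Aa : A (a \*o K x \+ w n).
      split; first exact: rkhs_spaceP.
      by rewrite lP// lK mulr0 add0r (wA n).2.
    have := mA _ Aa; rewrite rkhs_sqrZD// (rkhs_ipC Vx (wV n)).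
    rewrite (rkhs_reproducing x (wV n)) (rkhs_reproducing x Vx).
    by have := (wP n).2; move: (n.+1%:R^-1) => i; lra.
  have k1 := key s; have k2 := key (- s); move: (n.+1%:R^-1) nes k1 k2 => i nes k1 k2.
  rewrite ler_norml; apply/andP; split.
    rewrite -(ler_pM2l s0); nra.
  rewrite -(ler_pM2l s0); nra.
have zx0 x : z x = 0.
  apply/eqP; rewrite -normr_le0; apply/ler_addgt0Pl => e e0; rewrite addr0.
  have Vx := rkhs_section H x.
  have k0 : 0 <= K x x.
    by rewrite -(rkhs_reproducing x Vx) rkhs_ip_ge0.
  have [N NP] := wx0 x (e / 2) ltac:(lra).
  have d0 : 0 < (e / 2) ^+ 2 / (K x x + 1) by rewrite divr_gt0 ?exprn_gt0//; lra.
  move/cvgrPdist_lt : wz => /(_ _ d0)[N' _ NP'].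
  have /= := NP' (maxn N N') (leq_maxr _ _).
  set n := maxn N N'.
  have Vwz : V (w n \- z) by exact: rkhs_spaceB.
  rewrite sub0r normrN ger0_norm ?rkhs_ip_ge0// => small.
  have := rkhs_eval_sqr_le x Vwz => /= ev.
  have wn := NP n (leq_maxl _ _).
  have : `|w n x - z x| <= e / 2.
    rewrite -ler_sqr ?nnegrE//; last lra.
    rewrite real_normK ?num_real//.
    apply: le_trans ev _; rewrite mulrC.
    rewrite ltr_pdivlMr in small; last lra.
    apply: le_trans (ltW small); rewrite ler_wpM2l ?rkhs_ip_ge0//; lra.
  by rewrite !ler_norml in wn *; lra.
have z0 : z = fun=> 0 by apply/funext => x; exact: zx0.
have C1 n : 1 <= C ^+ 2 * ip (w n) (w n).
  have := lC _ (wV n); rewrite (wA n).2 normr1 => h.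
  rewrite -rkhs_norm_sqr// -exprMn; rewrite -[leLHS](expr1n _ 2).
  by rewrite ler_sqr ?nnegrE//; apply: le_trans h.
have d0 : 0 < (C ^+ 2 + 1)^-1 by rewrite invr_gt0; have := sqr_ge0 C; lra.
move/cvgrPdist_lt : wz => /(_ _ d0)[N _ NP].
have /= := NP N (leqnn _).
rewrite (_ : w N \- z = w N); last by rewrite z0; apply/funext => x /=; rewrite subr0.
rewrite sub0r normrN ger0_norm ?rkhs_ip_ge0// => small.
have := C1 N; apply/negP; rewrite -ltNge.
have C0 := sqr_ge0 C.
rewrite -[X in _ < X](@mulfV _ (C ^+ 2 + 1)); last by rewrite gt_eqF//; lra.
apply: (@le_lt_trans _ _ ((C ^+ 2 + 1) * ip (w N) (w N))).
  by rewrite ler_wpM2r ?rkhs_ip_ge0//; lra.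
by rewrite ltr_pM2l//; lra.
Qed.

End Rkhs.

(** * Euclidean geometry *)

Section Euclid.
Context (R : realType) (d : nat).
Implicit Types (u v w : 'rV[R]_d) (a : R).

Lemma dotC u v : dot u v = dot v u.
Proof. by apply: eq_bigr => i _; rewrite mulrC. Qed.

Lemma dotZl a u v : dot (a *: u) v = a * dot u v.
Proof. by rewrite /dot mulr_sumr; apply: eq_bigr => i _; rewrite mxE mulrA. Qed.

Lemma dotZr a u v : dot u (a *: v) = a * dot u v.
Proof. by rewrite dotC dotZl dotC. Qed.

Lemma dotBl u v w : dot (u - v) w = dot u w - dot v w.
Proof. by rewrite /dot -sumrB; apply: eq_bigr => i _; rewrite !mxE mulrBl. Qed.

Lemma dotBr u v w : dot w (u - v) = dot w u - dot w v.
Proof. by rewrite dotC dotBl !(dotC w). Qed.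

Lemma dotDl u v w : dot (u + v) w = dot u w + dot v w.
Proof. by rewrite /dot -big_split; apply: eq_bigr => i _; rewrite !mxE mulrDl. Qed.

Lemma dotDr u v w : dot w (u + v) = dot w u + dot w v.
Proof. by rewrite dotC dotDl !(dotC w). Qed.

Lemma dot0r u : dot u 0 = 0.
Proof. by rewrite /dot big1// => i _; rewrite mxE mulr0. Qed.

Lemma enorm0 : enorm (0 : 'rV[R]_d) = 0.
Proof. by rewrite /enorm dot0r sqrtr0. Qed.

Lemma dot_ge0 u : 0 <= dot u u.
Proof. by apply: sumr_ge0 => i _; rewrite -expr2 sqr_ge0. Qed.

Lemma dot_eq0 u : dot u u = 0 -> u = 0.
Proof.
move=> /eqP; rewrite psumr_eq0 => [/allP u0|i _]; last by rewrite -expr2 sqr_ge0.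
apply/rowP => i; rewrite mxE.
by have /= := u0 i; rewrite mem_index_enum mulf_eq0 orbb => /(_ isT)/eqP.
Qed.

Lemma enorm_ge0 u : 0 <= enorm u.
Proof. exact: sqrtr_ge0. Qed.

Lemma enorm_sqr u : enorm u ^+ 2 = dot u u.
Proof. by rewrite sqr_sqrtr// dot_ge0. Qed.

Lemma enorm_gt0 u : u <> 0 -> 0 < enorm u.
Proof.
move=> u0; rewrite lt_neqAle enorm_ge0 andbT eq_sym; apply/eqP => e0; apply: u0.
by apply: dot_eq0; rewrite -enorm_sqr e0 expr0n.
Qed.

Lemma enormZ a u : enorm (a *: u) = `|a| * enorm u.
Proof. by rewrite /enorm dotZl dotZr mulrA -expr2 sqrtrM ?sqr_ge0// sqrtr_sqr. Qed.

Definition direction u : 'rV[R]_d := (enorm u)^-1 *: u.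

Lemma enorm_direction u : u <> 0 -> enorm (direction u) = 1.
Proof.
move=> /enorm_gt0 u0; rewrite /direction enormZ ger0_norm ?invr_ge0 ?enorm_ge0//.
by rewrite mulVf// gt_eqF.
Qed.

Lemma dot_direction u : u <> 0 -> dot u (direction u) = enorm u.
Proof.
move=> /enorm_gt0 u0; rewrite /direction dotZr -enorm_sqr expr2 mulKf//.
by rewrite gt_eqF.
Qed.

Lemma directionZ a u : 0 < a -> direction (a *: u) = direction u.
Proof.
move=> a0; rewrite /direction enormZ gtr0_norm// scalerA invfM mulrAC mulVf ?mul1r//.
by rewrite gt_eqF.
Qed.

Lemma dot_unit u : enorm u = 1 -> dot u u = 1.
Proof. by move=> u1; rewrite -enorm_sqr u1 expr1n. Qed.

Lemma dot_unit_itv u v : enorm u = 1 -> enorm v = 1 -> -1 <= dot u v <= 1.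
Proof.
move=> /dot_unit u1 /dot_unit v1.
have := dot_ge0 (u - v); have := dot_ge0 (u + v).
by rewrite dotBl !dotBr dotDl !dotDr u1 v1 (dotC v u); lra.
Qed.

Section continuity.
Context (T : topologicalType).
Implicit Types (f g : T -> 'rV[R]_d) (x : T).

Lemma continuous_dot f g x : {for x, continuous f} -> {for x, continuous g} ->
  {for x, continuous (fun t => dot (f t) (g t))}.
Proof.
move=> cf cg; rewrite /dot /prop_for /continuous_at.
apply: (@cvg_big _ _ +%R 0) => [p|i _].
  exact: add_continuous.
apply: cvgM.
  by apply: (continuous_cvg _ (@coord_continuous _ _ _ _ _ _) cf).
by apply: (continuous_cvg _ (@coord_continuous _ _ _ _ _ _) cg).
Qed.

Lemma continuous_enorm f x : {for x, continuous f} ->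
  {for x, continuous (fun t => enorm (f t))}.
Proof.
move=> cf; rewrite /enorm.
apply: (@continuous_comp _ _ _ (fun t => dot (f t) (f t)) Num.sqrt).
  exact: continuous_dot.
exact: sqrt_continuous.
Qed.

Lemma continuous_direction f x : {for x, continuous f} -> f x <> 0 ->
  {for x, continuous (fun t => direction (f t))}.
Proof.
move=> cf f0; rewrite /direction.
apply: (@cvgZ _ _ _ _ _ (fun t => (enorm (f t))^-1) f) => //.
apply: cvgV; first by rewrite gt_eqF// enorm_gt0.
exact: continuous_enorm.
Qed.

End continuity.

Lemma is_derive_dot2 (p q : R -> 'rV[R]_d) (dp dq : 'rV[R]_d) (t : R) :
  is_derive t 1 p dp -> is_derive t 1 q dq ->
  is_derive t 1 (fun s => dot (p s) (q s)) (dot dp (q t) + dot (p t) dq).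
Proof.
move=> [p1 <-] [q1 <-]; rewrite !derive_mx// /dot -big_split/=.
have -> : (fun s => \sum_(i < d) p s 0 i * q s 0 i) =
    \sum_(i < d) (fun s => p s 0 i * q s 0 i).
  by apply/funext => s; rewrite fct_sumE.
apply: is_derive_sum => i; rewrite !mxE.
have di (c : R -> 'rV[R]_d) : derivable c t 1 ->
    is_derive t 1 (fun s => c s 0 i) ('D_1 (fun s => c s 0 i) t).
  by move=> dc; apply: derivableP; exact: (derivable_mxP _ _ _).1.
have := is_deriveM (di _ p1) (di _ q1).
by rewrite addrC /GRing.scale/= [in X in _ + X]mulrC.
Qed.

Lemma is_derive_dot (c : R -> 'rV[R]_d) (q w : 'rV[R]_d) (t : R) :
  is_derive t 1 c q -> is_derive t 1 (fun s => dot (c s) w) (dot q w).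
Proof.
move=> dc; have := is_derive_dot2 dc (is_derive_cst w t 1).
by rewrite dot0r addr0.
Qed.

End Euclid.

(** * Primitives of continuous functions *)

Section Primitive.
Context (R : realType).
Notation mu := (@lebesgue_measure R).
Implicit Types (f F : R -> R) (a b x : R).

Lemma continuous_integrable f a b : continuous f ->
  mu.-integrable `[a, b] (EFin \o f).
Proof.
move=> cf; apply: continuous_compact_integrable; first exact: segment_compact.
exact: continuous_subspaceT.
Qed.

Lemma is_derive_continuous (V : normedModType R) (g : R -> V) x (dg : V) :
  is_derive x 1 g dg -> {for x, continuous g}.
Proof. by move=> [dgx _]; exact/differentiable_continuous/derivable1_diffP. Qed.

Lemma primitive_of_vanishing f : continuous f -> (forall x, x <= 0 -> f x = 0) ->
  exists F, forall x, is_derive x 1 F (f x).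
Proof.
(* starting at -1, where f already vanishes, makes 0 an interior point *)
move=> cf f0; exists (fun x => \int[mu]_(t in `[-1, x]) f t) => x.
have [x0|x0] := ltP x 0.
  rewrite f0; last exact: ltW.
  apply: (near_eq_is_derive _ (is_derive_cst (0 : R) x 1)).
  near=> y; have y0 : y <= 0 by apply: ltW; near: y; exact: lt_nbhsl.
  rewrite /cst; apply/esym.
  transitivity (\int[mu]_(t in `[-1, y]) (0 : R)); last first.
    by rewrite Rintegral_cst// mul0r.
  apply: eq_Rintegral => t; rewrite inE/= in_itv/= => /andP[_ ty].
  by rewrite f0// (le_trans ty).
have [dF F'] : derivable (fun x => \int[mu]_(t in `[-1, x]) f t) x 1 /\
    (fun x => \int[mu]_(t in `[-1, x]) f t)^`() x = f x.
  apply: (@continuous_FTC1_closed _ f (-1) x (x + 1)).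
  - by rewrite ltrDl.
  - exact: continuous_integrable.
  - by apply: lt_le_trans x0; rewrite oppr_lt0.
  - exact: cf.
by rewrite -F' derive1E; apply: derivableP.
Unshelve. all: by end_near. Qed.

(** The integral of f over [a, x] is differentiable at x > a only.  Writing f as
    a constant plus a function vanishing on the negative half-line and one
    vanishing on the positive half-line gives a primitive on the whole line. *)
Lemma primitive_exists f : continuous f ->
  exists F, F 0 = 0 /\ forall x, is_derive x 1 F (f x).
Proof.
move=> cf.
pose fp x := f (Num.max x 0) - f 0; pose fn x := f (Num.min (- x) 0) - f 0.
have cmax : continuous (fun x : R => Num.max x 0).
  by move=> x; apply: continuous_max; [exact: cvg_id|exact: cvg_cst].
have cmin : continuous (fun x : R => Num.min (- x) 0).
  by move=> x; apply: continuous_min; [exact: opp_continuous|exact: cvg_cst].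
have [Fp dFp] : exists F, forall x, is_derive x 1 F (fp x).
  apply: primitive_of_vanishing => x; last first.
    by move=> x0; rewrite /fp max_r// subrr.
  apply: cvgB; last exact: cvg_cst.
  by apply: continuous_comp; [exact: cmax|exact: cf].
have [Fn dFn] : exists F, forall x, is_derive x 1 F (fn x).
  apply: primitive_of_vanishing => x; last first.
    by move=> x0; rewrite /fn min_r ?subrr// oppr_ge0.
  apply: cvgB; last exact: cvg_cst.
  by apply: continuous_comp; [exact: cmin|exact: cf].
pose F x := Fp x - Fn (- x) + f 0 * x.
have dF x : is_derive x 1 F (f x).
  have d1 : is_derive x 1 (Fn \o -%R) (fn (- x) * -1).
    by apply: is_derive1_comp; apply: is_deriveNid.
  have d2 : is_derive x 1 (fun x => f 0 * x) (f 0 * 1).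
    exact: (@is_deriveZ _ _ _ id (f 0) x 1 1).
  have <- : fp x - fn (- x) * -1 + f 0 * 1 = f x.
    by rewrite /fp /fn opprK; case: (leP x 0) => _; ring.
  exact: (is_deriveD (is_deriveB (dFp x) d1) d2).
exists (fun x => F x - F 0); split; first by rewrite subrr.
move=> x; rewrite -[f x]subr0.
by apply: is_deriveB; exact: is_derive_cst.
Qed.

Lemma integral_primitive f F a b : a < b -> continuous f ->
  (forall x, a < x < b -> is_derive x 1 F (f x)) ->
  {for a, continuous F} -> {for b, continuous F} ->
  \int[mu]_(t in `[a, b]) f t = F b - F a.
Proof.
move=> ab cf dF cFa cFb; rewrite /Rintegral.
rewrite (@continuous_FTC2 _ f F a b)//.
- exact: continuous_subspaceT.
- split.
  + by move=> x; rewrite in_itv/= => /dF[].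
  + exact: cvg_at_right_filter.
  + exact: cvg_at_left_filter.
- by move=> x; rewrite in_itv/= derive1E => /dF[].
Qed.

End Primitive.

(** * Integrals of continuous functions over one period *)

Section PeriodIntegral.
Context (R : realType).
Notation mu := (@lebesgue_measure R).
Implicit Types (f g h : R -> R) (a b : R).

Definition period_integral f : R := \int[mu]_(t in `[0, 2 * pi]) f t.
Notation I := period_integral.

Lemma two_pi_gt0 : 0 < 2 * pi :> R.
Proof. by rewrite mulr_gt0 ?pi_gt0. Qed.

Lemma eq_period_integral f g :
  (forall t, 0 <= t <= 2 * pi -> f t = g t) -> I f = I g.
Proof. by move=> fg; apply: eq_Rintegral => t; rewrite inE/= in_itv/= => /fg. Qed.

Lemma period_integralD f g : continuous f -> continuous g ->
  I (fun t => f t + g t) = I f + I g.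
Proof. by move=> cf cg; apply: RintegralD => //; exact: continuous_integrable. Qed.

Lemma period_integralB f g : continuous f -> continuous g ->
  I (fun t => f t - g t) = I f - I g.
Proof. by move=> cf cg; apply: RintegralB => //; exact: continuous_integrable. Qed.

Lemma period_integralZ a f : continuous f -> I (fun t => a * f t) = a * I f.
Proof. by move=> cf; apply: RintegralZl => //; exact: continuous_integrable. Qed.

Lemma period_integral_ge0 f : (forall t, 0 <= t <= 2 * pi -> 0 <= f t) -> 0 <= I f.
Proof. by move=> f0; apply: Rintegral_ge0 => t /=; rewrite in_itv/=; exact: f0. Qed.

Lemma ler_period_integral f g : continuous f -> continuous g ->
  (forall t, 0 <= t <= 2 * pi -> f t <= g t) -> I f <= I g.
Proof.
by move=> cf cg fg; apply: le_Rintegral => //; exact: continuous_integrable.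
Qed.

Lemma norm_period_integral_le f g : continuous f -> continuous g ->
  (forall t, 0 <= t <= 2 * pi -> `|f t| <= g t) -> `|I f| <= I g.
Proof.
move=> cf cg fg; apply: le_trans (le_normr_Rintegral _ _) _ => //.
  exact: continuous_integrable.
apply: (@ler_period_integral (fun t => `|f t|) g) => // x.
by apply: continuous_comp; [exact: cf|exact: norm_continuous].
Qed.

Lemma period_integral_gt0 f (s : R) : continuous f ->
  (forall t, 0 <= t <= 2 * pi -> 0 <= f t) ->
  0 <= s <= 2 * pi -> 0 < f s -> 0 < I f.
Proof.
move=> cf f0 sI fs; have pi0 := two_pi_gt0.
have [F [_ dF]] := primitive_exists cf.
have IE a b : a < b -> \int[mu]_(t in `[a, b]) f t = F b - F a.
  have cF x := is_derive_continuous (dF x).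
  by move=> ab; apply: integral_primitive.
have F1 a b : 0 <= a -> a <= b -> b <= 2 * pi -> F a <= F b.
  move=> a0; rewrite le_eqVlt => /predU1P[->//|ab] b1.
  rewrite -subr_ge0 -IE//; apply: Rintegral_ge0 => t /=; rewrite in_itv/= => tab.
  by apply: f0; lra.
rewrite /I IE// subr_gt0 lt_neqAle F1 ?lexx ?ltW// andbT; apply/eqP => F02.
have cst t : 0 <= t <= 2 * pi -> F t = F 0.
  move=> tI; apply/eqP; rewrite eq_le; apply/andP; split; last by apply: F1; lra.
  by rewrite F02; apply: F1; lra.
(* F is constant on the period, so f vanishes inside it and, by continuity, at
   the end points as well *)
have in0 (t : R) : 0 < t < 2 * pi -> f t = 0.
  move=> /andP[t0 t1]; have [_ <-] := dF t.
  have : is_derive t 1 F 0.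
    apply: (near_eq_is_derive _ (is_derive_cst (F 0) t 1)).
    near=> x; rewrite /cst cst//.
    apply/andP; split; apply: ltW; near: x.
      exact: lt_nbhsr.
    exact: lt_nbhsl.
  by case.
have : \forall x \near s, 0 < f x by exact: (cvgr_gt (f s) (cf s)).
case=> e /= e0 eP.
(* a point t of the open period so close to s that f t > 0 *)
pose t := if s <= pi then s + Num.min (e / 2) (pi / 2)
  else s - Num.min (e / 2) (pi / 2).
have m0 : 0 < Num.min (e / 2) (pi / 2).
  by rewrite lt_min !divr_gt0//=; have := pi_gt0 R.
have m1 : Num.min (e / 2) (pi / 2) <= e / 2 by rewrite ge_min lexx.
have m2 : Num.min (e / 2) (pi / 2) <= pi / 2 by rewrite ge_min lexx orbT.
have : 0 < f t.
  apply: eP; rewrite /ball_/= /t; move: (Num.min _ _) m0 m1 m2 => x x0 x1 x2.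
  by case: ifP => _; [rewrite opprD addNKr normrN|rewrite opprB addrC subrK];
    rewrite ger0_norm; lra.
rewrite in0 ?ltxx// /t; move: (Num.min _ _) m0 m1 m2 => x x0 x1 x2.
by have := pi_gt0 R; case: (leP s pi) => *; lra.
Unshelve. all: by end_near. Qed.

End PeriodIntegral.

(** * Regular curves and the functionals they define *)

Section RegularExtension.
Context (R : realType) (d : nat) (M : manifold1) (c : R -> 'rV[R]_d).

(** Integrals, compactness and arc lengths are easier to handle with functions on
    the whole line, but a curve on the segment is meaningful near [0, 2 pi] only.
    P and Q extend its position and velocity continuously, the speed staying away
    from zero so that arc length covers the line. *)
Record regular_extension (P Q : R -> 'rV[R]_d) (U : set R) : Prop := {
  ext_open : open U ;
  ext_params : params M `<=` U ;
  ext_cont_pos : continuous P ;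
  ext_cont_vel : continuous Q ;
  ext_speed : exists2 m, 0 < m & forall t, m <= enorm (Q t) ;
  ext_pos : forall t, U t -> P t = c t ;
  ext_vel : forall t, U t -> Q t = c^`() t ;
  ext_derive : forall t, U t -> is_derive t 1 c (Q t) ;
  ext_smooth : forall n t, U t -> derivable c^`(n) t 1 ;
  ext_periodic : M = circle ->
    forall t, [/\ U t, P (t + 2 * pi) = P t & Q (t + 2 * pi) = Q t]
}.

Arguments ext_cont_pos {P Q U} _.
Arguments ext_cont_vel {P Q U} _.

Context (P Q : R -> 'rV[R]_d) (U : set R) (E : regular_extension P Q U).

Lemma ext_vel_neq0 t : Q t <> 0.
Proof.
move=> Qt0; have [m m0 /(_ t)] := ext_speed E.
by rewrite Qt0 enorm0; lra.
Qed.

Lemma params_period (t : R) : 0 <= t <= 2 * pi -> params M t.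
Proof. by move=> tI; case: M => //=; rewrite in_itv. Qed.

Lemma points_params (t : R) : points M t -> params M t.
Proof. by case: M. Qed.

Definition sphere_direction t : set_type (@sphere R d) :=
  exist _ (direction (Q t)) (mem_set (enorm_direction (@ext_vel_neq0 t))).

Lemma continuous_sphere_direction : continuous sphere_direction.
Proof.
apply: continuous_comp_initial => t.
rewrite (_ : set_val \o sphere_direction = fun s => direction (Q s)); last first.
  by [].
exact: (continuous_direction (ext_cont_vel E t) (@ext_vel_neq0 t)).
Qed.

Lemma continuous_speed : continuous (fun t => enorm (Q t)).
Proof. move=> t; exact: continuous_enorm (ext_cont_vel E t). Qed.

Lemma varifoldE (w : phase R d -> R) :
  continuous (fun t => w (P t, sphere_direction t)) ->
  varifold M c w =
  period_integral (fun t => w (P t, sphere_direction t) * enorm (Q t)).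
Proof.
move=> cw; have cG : continuous (fun t => w (P t, sphere_direction t) * enorm (Q t)).
  by move=> t; apply: cvgM; [exact: cw|exact: continuous_speed].
transitivity (\int[lebesgue_measure]_(t in points M)
    (w (P t, sphere_direction t) * enorm (Q t))).
  apply: eq_Rintegral => t; rewrite inE => /points_params/(ext_params E) Ut.
  rewrite -(ext_vel E Ut) -(ext_pos E Ut) -/(direction (Q t)).
  rewrite (insubT (fun x => x \in @sphere R d) (mem_set (enorm_direction (@ext_vel_neq0 t)))).
  by [].
rewrite /period_integral /points; case: M => //.
rewrite Rintegral_itv_bndo_bndc//.
apply: integrableS (continuous_integrable 0 (2 * pi) cG) => // t /=.
by rewrite !in_itv/= => /andP[-> /ltW].
Qed.

End RegularExtension.

Arguments ext_cont_pos {R d M c P Q U} _.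
Arguments ext_cont_vel {R d M c P Q U} _.
Arguments ext_vel_neq0 {R d M c P Q U} E.
Arguments continuous_speed {R d M c P Q U} E.
Arguments continuous_sphere_direction {R d M c P Q U} E.

Section KernelIdentity.
Context (R : realType) (d : nat) (M : manifold1) (rho gamma : R -> R).
Context (H : rkhs (@varifold_kernel R d rho gamma)).
Hypothesis rhoC1 : C1_on `[0, +oo[ rho.
Hypothesis gammaC1 : C1_on `[(-1), 1] gamma.

Lemma C1_on_comp_continuous (T : topologicalType) (A : set R) (f : R -> R) (g : T -> R) :
  C1_on A f -> (forall t, A (g t)) -> continuous g -> continuous (f \o g).
Proof.
move=> [h [dh _ hE]] Ag cg; rewrite (_ : f \o g = h \o g); last first.
  by apply/funext => t /=; rewrite hE.
move=> t; apply: continuous_comp; first exact: cg.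
exact/differentiable_continuous/derivable1_diffP.
Qed.

Lemma continuous_radial_section (x : 'rV[R]_d) (P : R -> 'rV[R]_d) :
  continuous P -> continuous (fun t => radial_kernel rho x (P t)).
Proof.
move=> cP; apply: (@C1_on_comp_continuous _ _ rho (fun t => enorm (x - P t) ^+ 2) rhoC1).
  by move=> t /=; rewrite in_itv/= sqr_ge0.
move=> t; rewrite (_ : (fun _ => _) = (fun t => dot (x - P t) (x - P t))); last first.
  by apply/funext => s; rewrite enorm_sqr.
have cxP : {for t, continuous (fun t => x - P t)} by apply: cvgB; [exact: cvg_cst|exact: cP].
exact: (continuous_dot cxP cxP).
Qed.

Lemma continuous_zonal_section (u : 'rV[R]_d) (Q : R -> 'rV[R]_d) :
  enorm u = 1 -> continuous Q -> (forall t, Q t <> 0) ->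
  continuous (fun t => gamma (dot u (direction (Q t)))).
Proof.
move=> u1 cQ Q0.
apply: (@C1_on_comp_continuous _ _ gamma (fun t => dot u (direction (Q t))) gammaC1).
  by move=> t /=; rewrite in_itv/= dot_unit_itv// enorm_direction.
move=> t; have cu : {for t, continuous (fun=> u)} by exact: cvg_cst.
exact: (continuous_dot cu (continuous_direction (cQ t) (Q0 t))).
Qed.

Context (c1 c2 P1 P2 Q1 Q2 : R -> 'rV[R]_d) (U1 U2 : set R).
Hypothesis E1 : regular_extension M c1 P1 Q1 U1.
Hypothesis E2 : regular_extension M c2 P2 Q2 U2.

Let continuous_section c P Q U (E : regular_extension M c P Q U) p :
  continuous (fun t => @varifold_kernel R d rho gamma p (P t, sphere_direction E t)).
Proof.
move=> t; apply: cvgM; first exact: (continuous_radial_section (ext_cont_pos E)).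
apply: (@continuous_zonal_section (\val p.2) Q _ _ _ t).
- by case: p => x [u /= /set_mem].
- exact: ext_cont_vel E.
- exact: ext_vel_neq0 E.
Qed.

(** The dual norm tests elements of the unit ball, into which the section is scaled. *)
Lemma dVar0_section (p : phase R d) : dVar H M c1 c2 = 0%E ->
  varifold M c1 (@varifold_kernel R d rho gamma p) =
  varifold M c2 (@varifold_kernel R d rho gamma p).
Proof.
move=> D0; set k := @varifold_kernel R d rho gamma p.
have Hk : rkhs_space H k by exact: rkhs_section.
have n0 := rkhs_norm_ge0 H k.
pose a := (rkhs_norm H k + 1)^-1.
have a0 : 0 < a by rewrite invr_gt0; lra.
have vZ c P Q U (E : regular_extension M c P Q U) :
    varifold M c (a \*o k) = a * varifold M c k.
  have cE := @continuous_section _ _ _ _ E p.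
  rewrite (varifoldE cE) (varifoldE (E := E)); last first.
    by move=> t; apply: cvgM; [exact: cvg_cst|exact: cE].
  rewrite -period_integralZ; last first.
    by move=> t; apply: cvgM; [exact: cE|exact: continuous_speed E t].
  by apply: eq_period_integral => t _ /=; rewrite mulrA.
have : (`|varifold M c1 (a \*o k) - varifold M c2 (a \*o k)|%:E <= 0)%E.
  rewrite -D0; apply: ereal_sup_ubound; exists (a \*o k) => //; split.
    exact: rkhs_spaceZ.
  rewrite rkhs_normZ// gtr0_norm// /a mulrC ler_pdivrMr; lra.
rewrite (vZ _ _ _ _ E1) (vZ _ _ _ _ E2) -mulrBr lee_fin normr_le0.
by rewrite mulf_eq0 (gt_eqF a0) orFb subr_eq0 => /eqP.
Qed.

Hypothesis universal : C0_universal d rho.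

(** The sections of the kernel at the points (x, u), for a fixed unit vector u,
    are those of the radial kernel times gamma (u . _).  So the equality of the
    varifolds says that a functional attached to a signed measure on space
    vanishes on the sections of the radial kernel.  It is bounded, hence vanishes
    on the whole space of that kernel, and on every test function by density. *)
Lemma dVar0_test_function (u : 'rV[R]_d) (f : 'rV[R]_d -> R) :
  dVar H M c1 c2 = 0%E -> enorm u = 1 -> @C0 R _ f ->
  period_integral (fun t => f (P1 t) * (gamma (dot u (direction (Q1 t))) * enorm (Q1 t))) =
  period_integral (fun t => f (P2 t) * (gamma (dot u (direction (Q2 t))) * enorm (Q2 t))).
Proof.
move=> D0 u1 Cf; have [Hr [HrC0 dense]] := universal.
pose a (Q : R -> 'rV[R]_d) t := gamma (dot u (direction (Q t))) * enorm (Q t).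
have ca c P Q U (E : regular_extension M c P Q U) : continuous (a Q).
  move=> t; apply: cvgM; last exact: continuous_speed E t.
  exact: (continuous_zonal_section u1 (ext_cont_vel E) (ext_vel_neq0 E)).
have caN c P Q U (E : regular_extension M c P Q U) : continuous (fun t => `|a Q t|).
  by move=> t; apply: continuous_comp; [exact: ca E t|exact: norm_continuous].
have cfa (w : 'rV[R]_d -> R) c P Q U (E : regular_extension M c P Q U) : continuous w ->
    continuous (fun t => w (P t) * a Q t).
  move=> cw t; apply: cvgM; last exact: ca E t.
  by apply: continuous_comp; [exact: ext_cont_pos E t|exact: cw].
pose l (w : 'rV[R]_d -> R) := period_integral (fun t => w (P1 t) * a Q1 t) -
  period_integral (fun t => w (P2 t) * a Q2 t).
have lP (b : R) w w' : continuous w -> continuous w' -> l (b \*o w \+ w') = b * l w + l w'.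
  move=> cw cw'.
  suff lP1 c P Q U (E : regular_extension M c P Q U) :
      period_integral (fun t => (b \*o w \+ w') (P t) * a Q t) =
      b * period_integral (fun t => w (P t) * a Q t) +
      period_integral (fun t => w' (P t) * a Q t).
    by rewrite /l (lP1 _ _ _ _ E1) (lP1 _ _ _ _ E2); ring.
  rewrite -period_integralZ; last exact: cfa E _.
  rewrite -period_integralD; last 2 first.
  - by move=> t; apply: cvgM; [exact: cvg_cst|exact: cfa E _ t].
  - exact: cfa E _.
  by apply: eq_period_integral => t _ /=; ring.
pose A := period_integral (fun t => `|a Q1 t|) + period_integral (fun t => `|a Q2 t|).
have A0 : 0 <= A by rewrite addr_ge0//; apply: period_integral_ge0.
have lb w B : continuous w -> (forall x, `|w x| <= B) -> `|l w| <= B * A.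
  move=> cw wB.
  suff lb1 c P Q U (E : regular_extension M c P Q U) :
      `|period_integral (fun t => w (P t) * a Q t)| <=
      B * period_integral (fun t => `|a Q t|).
    apply: le_trans (ler_normB _ _) _; rewrite mulrDr lerD//; [exact: lb1 E1|exact: lb1 E2].
  rewrite -period_integralZ; last exact: caN E.
  apply: norm_period_integral_le; first exact: cfa E _.
    by move=> t; apply: cvgM; [exact: cvg_cst|exact: caN E t].
  by move=> t _; rewrite normrM ler_wpM2r.
have lH w : rkhs_space Hr w -> l w = 0.
  apply: (rkhs_functional_eq0 (C := Num.sqrt (rho 0) * A)).
  - move=> b w1 w2 Hw1 Hw2; apply: lP; [exact: (HrC0 _ Hw1).1|exact: (HrC0 _ Hw2).1].
  - move=> w1 Hw1; rewrite mulrAC; apply: lb; first exact: (HrC0 _ Hw1).1.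
    move=> x; rewrite -sqrtr_sqr /rkhs_norm.
    have r0 : 0 <= rho 0.
      have := rkhs_ip_ge0 (rkhs_section Hr x).
      rewrite rkhs_reproducing; last exact: rkhs_section.
      by rewrite /radial_kernel subrr enorm0 expr0n.
    rewrite -sqrtrM// ler_wsqrtr//.
    by have := rkhs_eval_sqr_le x Hw1; rewrite /radial_kernel subrr enorm0 expr0n.
  - move=> x; pose p : phase R d := (x, exist _ u (mem_set u1)).
    have := dVar0_section p D0.
    rewrite (varifoldE (@continuous_section _ _ _ _ E1 p)).
    rewrite (varifoldE (@continuous_section _ _ _ _ E2 p)) => e.
    apply/eqP; rewrite subr_eq0; apply/eqP.
    rewrite (_ : (fun t => _) = (fun t => varifold_kernel rho gamma p
      (P1 t, sphere_direction E1 t) * enorm (Q1 t))); last first.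
      by apply/funext => t; rewrite /a mulrA.
    rewrite e; congr period_integral.
    by apply/funext => t; rewrite /a mulrA.
apply/eqP; rewrite -subr_eq0 -normr_le0; apply/ler_addgt0Pl => e e0; rewrite addr0.
have A1 : 0 < A + 1 by lra.
have [w Hw fw] := dense f Cf (e / (A + 1)) ltac:(exact: divr_gt0).
have cw := (HrC0 _ Hw).1.
have -> : period_integral (fun t => f (P1 t) * a Q1 t) -
  period_integral (fun t => f (P2 t) * a Q2 t) = l f by [].
have lfw : l f = l (f \- w).
  rewrite (_ : f \- w = (-1) \*o w \+ f); last by apply/funext => x /=; ring.
  by rewrite (lP _ _ _ cw Cf.1) (lH _ Hw); ring.
rewrite lfw; apply: (@le_trans _ _ (e / (A + 1) * A)).
  have cf := Cf.1; apply: lb => // x; exact: (cvgB (cf x) (cw x)).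
rewrite mulrAC ler_pdivrMr// ler_pM2l//; lra.
Qed.

End KernelIdentity.

(** * Equality of the tangents at points with one tangent per curve *)

Section Bump.
Context (R : realType) (d : nat).
Implicit Types (x y : 'rV[R]_d) (e : R).

Definition bump x e y : R := Num.max 0 (1 - `|y - x| / e).

Lemma bump_ge0 x e y : 0 <= bump x e y.
Proof. by rewrite le_max lexx. Qed.

Lemma bump_center x e : bump x e x = 1.
Proof. by rewrite /bump subrr normr0 mul0r subr0 max_r. Qed.

Lemma bump_eq0 x e y : 0 < e -> e <= `|y - x| -> bump x e y = 0.
Proof. by move=> e0 ey; rewrite /bump max_l// subr_le0 ler_pdivlMr// mul1r. Qed.

Lemma continuous_bump x e : continuous (bump x e).
Proof.
move=> y; have cyx : {for y, continuous (fun z : 'rV[R]_d => `|z - x|)}.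
  have cid : {for y, continuous (fun z : 'rV[R]_d => z)} by exact: cvg_id.
  have cx : {for y, continuous (fun z : 'rV[R]_d => x)} by exact: cst_continuous.
  exact: (cvg_norm (cvgB cid cx)).
have ck (k : R) : {for y, continuous (fun z : 'rV[R]_d => k)} by exact: cst_continuous.
have c1 : {for y, continuous (fun z : 'rV[R]_d => 1 - `|z - x| / e)}.
  exact: (cvgB (ck 1) (cvgM cyx (ck e^-1))).
exact: (continuous_max (ck 0) c1).
Qed.

Lemma bump_C0 x e : 0 < e -> C0 (bump x e).
Proof.
move=> e0; split; first exact: continuous_bump.
move=> r r0; exists (closed_ball x e).
  apply: bounded_closed_compact; last exact: closed_ball_closed.
  exists (`|x| + e); split; first exact: num_real.
  move=> M xM y; rewrite closed_ballE// /closed_ball_/= => yx.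
  apply/ltW; apply: le_lt_trans xM.
  rewrite -[y](subrKC x) (le_trans (ler_normD _ _))// lerD2l distrC; exact: yx.
move=> y; rewrite closed_ballE// /closed_ball_/= => /negP; rewrite -ltNge => yx.
by rewrite bump_eq0 ?normr0// distrC ltW.
Qed.

End Bump.

Section Concentration.
Context (R : realType) (d : nat).
Implicit Types (P Q : R -> 'rV[R]_d) (h v : R -> R) (x : 'rV[R]_d).

(** By compactness, the parameters in the period whose position is close to x are
    close to preimages of x, where h has the value h0. *)
Lemma bump_period_integral_concentrates P h v x (h0 eta : R) :
  continuous P -> continuous h -> continuous v -> (forall t, 0 <= v t) -> 0 < eta ->
  (forall t, 0 <= t <= 2 * pi -> P t = x -> h t = h0) ->
  \forall e \near 0^'+,
    `|period_integral (fun t => bump x e (P t) * (h t * v t)) -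
      h0 * period_integral (fun t => bump x e (P t) * v t)| <=
    eta * period_integral (fun t => bump x e (P t) * v t).
Proof.
move=> cP ch cv v0 eta0 hx.
have close : \forall e \near 0^'+, `[0, 2 * pi] `<=`
    [set t | `|P t - x| < e -> `|h t - h0| <= eta].
  have [near_cover _] := @compact_near_coveringP R `[0, 2 * pi].
  apply: (near_cover (@segment_compact R 0 (2 * pi))) => t /=; rewrite in_itv/= => tI.
  have cPx : continuous (fun t => `|P t - x|).
    move=> s; apply: (@cvg_norm _ _ _ _ _ (fun t => P t - x)).
    exact: (cvgB (cP s) (cvg_cst x)).
  have [Ptx|Ptx] := pselect (P t = x).
    near=> s e => /= _; near: s.
    have := hx t tI Ptx => <-.
    exact: (@cvgr_distC_le _ R^o _ _ _ h (h t) (ch t) eta eta0).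
  have d0 : 0 < `|P t - x| by rewrite normr_gt0 subr_eq0; apply/eqP.
  have d2 : `|P t - x| / 2 < `|P t - x| by lra.
  near=> s e => /= Pse; exfalso.
  have : `|P t - x| / 2 < `|P s - x|.
    by near: s; exact: (cvgr_gt _ (cPx t)).
  have : e < `|P t - x| / 2.
    by near: e; apply: nbhs_right_lt; rewrite divr_gt0.
  lra.
near=> e.
have e0 : 0 < e by near: e; exact: nbhs_right_gt.
have cb : continuous (fun t => bump x e (P t)).
  by move=> s; apply: continuous_comp; [exact: cP|exact: continuous_bump].
have cbv : continuous (fun t => bump x e (P t) * v t).
  by move=> s; apply: cvgM; [exact: cb|exact: cv].
rewrite -!period_integralZ// -period_integralB; last 2 first.
- move=> s; apply: cvgM; first exact: cb.
  by apply: cvgM; [exact: ch|exact: cv].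
- by move=> s; apply: cvgM; [exact: cvg_cst|exact: cbv].
apply: norm_period_integral_le.
- move=> s; apply: cvgB; last by apply: cvgM; [exact: cvg_cst|exact: cbv].
  by apply: cvgM; [exact: cb|apply: cvgM; [exact: ch|exact: cv]].
- by move=> s; apply: cvgM; [exact: cvg_cst|exact: cbv].
move=> t tI; rewrite (_ : _ - _ = (h t - h0) * (bump x e (P t) * v t)); last ring.
rewrite normrM (ger0_norm (mulr_ge0 (bump_ge0 _ _ _) (v0 t))).
have [Pt|Pt] := leP e `|P t - x|; first by rewrite bump_eq0// mul0r !mulr0.
rewrite ler_wpM2r ?mulr_ge0 ?bump_ge0//.
have : [set t | `|P t - x| < e -> `|h t - h0| <= eta] t.
  have K : `[0, 2 * pi] `<=` [set t | `|P t - x| < e -> `|h t - h0| <= eta].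
    by near: e.
  by apply: K; rewrite /= in_itv.
exact.
Unshelve. all: by end_near. Qed.

End Concentration.

(** Up to errors eta, G p = g q and g p = G q.  Subtracting gives G = g; then
    p = q, so neither vanishes, and s p = s' q gives s = s'. *)
Lemma balanced_masses (R : realType) (G g s s' : R) : 0 < G ->
  (forall eta, 0 < eta -> exists p q, [/\ 0 < p + q, 0 <= p /\ 0 <= q,
     `|G * p - g * q| <= eta * (p + q), `|g * p - G * q| <= eta * (p + q) &
     `|s * p - s' * q| <= eta * (p + q)]) ->
  s = s' /\ exists2 eta, 0 < eta & forall p q, 0 < p + q ->
    `|G * p - g * q| <= eta * (p + q) -> p <> 0 /\ q <> 0.
Proof.
move=> G0 H.
have gap eta p q : 0 < p + q -> 0 <= p -> 0 <= q -> `|G * p - g * q| <= eta * (p + q) ->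
    `|g * p - G * q| <= eta * (p + q) -> `|G - g| <= 2 * eta.
  move=> pq p0 q0 h1 h2; rewrite -(ler_pM2r pq) -(gtr0_norm pq) -normrM.
  rewrite (_ : (G - g) * _ = (G * p - g * q) - (g * p - G * q)); last ring.
  by rewrite (gtr0_norm pq) (le_trans (ler_normB _ _))//; lra.
have gG : g = G.
  apply/eqP; rewrite eq_sym -subr_eq0 -normr_le0; apply/ler_addgt0Pl => e e0.
  rewrite addr0; have [p [q [pq [p0 q0] h1 h2 _]]] := H (e / 2) ltac:(lra).
  by have := gap _ _ _ pq p0 q0 h1 h2; lra.
subst g; split; last first.
  exists (G / 2); first lra; move=> p q pq h1.
  rewrite ler_norml in h1; split => [p0|q0]; [subst p|subst q]; nra.
apply/eqP; rewrite -subr_eq0 -normr_le0; apply/ler_addgt0Pl => e e0; rewrite addr0.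
pose K := 2 + `|s + s'| / G.
have K0 : 0 < K.
  by rewrite /K ltr_pwDl// divr_ge0// ltW.
have [p [q [pq [p0 q0] h1 _ h3]]] := H (e / K) ltac:(exact: divr_gt0).
rewrite -(ler_pM2r pq) -(gtr0_norm pq) -normrM.
rewrite (_ : (s - s') * _ = 2 * (s * p - s' * q) - (s + s') * (p - q)); last ring.
rewrite (gtr0_norm pq) (le_trans (ler_normB _ _))// !normrM (ger0_norm (ler0n _ 2)).
have h4 : `|p - q| <= e / K / G * (p + q).
  rewrite -(ler_pM2l G0) -{1}(gtr0_norm G0) -normrM mulrBr (le_trans h1)//.
  by rewrite le_eqVlt; apply/orP; left; apply/eqP; field; rewrite !gt_eqF.
apply: (@le_trans _ _ (2 * (e / K * (p + q)) + `|s + s'| * (e / K / G * (p + q)))).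
  by apply: lerD; apply: ler_wpM2l.
rewrite (_ : _ + _ = K * (e / K) * (p + q)); last by rewrite /K; ring.
by rewrite mulrCA mulfV ?gt_eqF// mulr1.
Qed.

Section TangentsAgree.
Context (R : realType) (d : nat) (M : manifold1) (gamma : R -> R).
Hypothesis gammaC1 : C1_on `[(-1), 1] gamma.
Hypothesis gamma1 : 0 < gamma 1.
Hypothesis gamma_odd : forall t, -1 <= t <= 1 -> t <> 0 -> gamma (- t) <> gamma t.

Context (c1 c2 P1 P2 Q1 Q2 : R -> 'rV[R]_d) (U1 U2 : set R).
Hypothesis E1 : regular_extension M c1 P1 Q1 U1.
Hypothesis E2 : regular_extension M c2 P2 Q2 U2.

Hypothesis test : forall (u : 'rV[R]_d) f, enorm u = 1 -> @C0 R _ f ->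
  period_integral (fun t => f (P1 t) * (gamma (dot u (direction (Q1 t))) * enorm (Q1 t))) =
  period_integral (fun t => f (P2 t) * (gamma (dot u (direction (Q2 t))) * enorm (Q2 t))).

Let mass (P Q : R -> 'rV[R]_d) x e := period_integral (fun t => bump x e (P t) * enorm (Q t)).

Let mass_continuous (c P Q : R -> 'rV[R]_d) U
    (E : regular_extension M c P Q U) (x : 'rV[R]_d) (e : R) :
  continuous (fun t => bump x e (P t) * enorm (Q t)).
Proof.
move=> t; apply: cvgM; last exact: continuous_speed E t.
by apply: continuous_comp; [exact: ext_cont_pos E t|exact: continuous_bump].
Qed.

Let mass_ge0 (P Q : R -> 'rV[R]_d) x (e : R) : 0 <= mass P Q x e.
Proof. by apply: period_integral_ge0 => t _; rewrite mulr_ge0 ?bump_ge0 ?enorm_ge0. Qed.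

Let mass_gt0 (c P Q : R -> 'rV[R]_d) U (E : regular_extension M c P Q U) e t :
  0 <= t <= 2 * pi -> 0 < mass P Q (P t) e.
Proof.
move=> tI; apply: (@period_integral_gt0 _ _ t) => //.
- exact: mass_continuous E _ _.
- by move=> s _; rewrite mulr_ge0 ?bump_ge0 ?enorm_ge0.
- by rewrite bump_center mul1r enorm_gt0//; exact: ext_vel_neq0 E t.
Qed.

Let mass_vanishes (c P Q : R -> 'rV[R]_d) U (E : regular_extension M c P Q U) x :
  (forall t, 0 <= t <= 2 * pi -> P t <> x) -> \forall e \near 0^'+, mass P Q x e = 0.
Proof.
move=> Px.
(* there being no preimage of x, the function 0 may be compared with the value 1 *)
have := @bump_period_integral_concentrates _ _ P (fun=> 0) (fun t => enorm (Q t)) x 1 2^-1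
  (ext_cont_pos E) _ (continuous_speed E) (fun t => enorm_ge0 (Q t)) _ _.
have c0 : continuous (fun _ : R => 0 : R) by exact: cst_continuous.
have h2 : 0 < 2^-1 :> R by rewrite invr_gt0.
move=> /(_ c0 h2 (fun t tI Pt => False_ind _ (Px t tI Pt))).
apply: filterS => e.
rewrite (_ : (fun t => bump x e (P t) * (0 * enorm (Q t))) =
  (fun t => 0 * (bump x e (P t) * enorm (Q t)))); last first.
  by apply/funext => t; rewrite !mul0r mulr0.
rewrite period_integralZ; last exact: mass_continuous E _ _.
rewrite mul0r mul1r sub0r normrN -/(mass P Q x e).
by have := mass_ge0 P Q x e => m0; rewrite ger0_norm//; lra.
Qed.

(** Test functions concentrating at x weigh the first varifold, paired with the
    kernel section at u, by gamma (u . tau) times the length of the first curve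
    near x, and similarly for the second.  Equating both for u = tau and
    u = sigma shows that the two lengths are equivalent, so that x lies on the
    first curve too; then gamma (u . tau) = gamma (u . sigma) for every u.  If tau
    and sigma were distinct, their normalised difference u would satisfy
    u . sigma = - u . tau <> 0, against the asymmetry of gamma. *)
Lemma tangents_agree x (tau sigma : 'rV[R]_d) : enorm tau = 1 -> enorm sigma = 1 ->
  (forall t, 0 <= t <= 2 * pi -> P1 t = x -> direction (Q1 t) = tau) ->
  (forall t, 0 <= t <= 2 * pi -> P2 t = x -> direction (Q2 t) = sigma) ->
  (exists2 t, 0 <= t <= 2 * pi & P2 t = x) ->
  tau = sigma /\ exists2 t, 0 <= t <= 2 * pi & P1 t = x.
Proof.
move=> tau1 sigma1 T1 T2 [t2 t2I P2x].
pose m1 := mass P1 Q1 x; pose m2 := mass P2 Q2 x.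
have m20 e : 0 < m2 e by rewrite /m2 -P2x; exact: mass_gt0 E2 _ _ t2I.
have m10 e : 0 <= m1 e by exact: mass_ge0.
have m120 e : 0 < m1 e + m2 e by have := m10 e; have := m20 e; lra.
have balance (u : 'rV[R]_d) (eta : R) : enorm u = 1 -> 0 < eta -> \forall e \near 0^'+,
    `|gamma (dot u tau) * m1 e - gamma (dot u sigma) * m2 e| <= eta * (m1 e + m2 e).
  move=> u1 eta0.
  have conc c P Q U (E : regular_extension M c P Q U) rho :
      (forall t, 0 <= t <= 2 * pi -> P t = x -> direction (Q t) = rho) ->
      \forall e \near 0^'+,
        `|period_integral (fun t => bump x e (P t) *
            (gamma (dot u (direction (Q t))) * enorm (Q t))) -
          gamma (dot u rho) * mass P Q x e| <= eta * mass P Q x e.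
    move=> T; apply: bump_period_integral_concentrates eta0 _.
    - exact: ext_cont_pos E.
    - exact: (continuous_zonal_section gammaC1 u1 (ext_cont_vel E) (ext_vel_neq0 E)).
    - exact: continuous_speed E.
    - by move=> t; exact: enorm_ge0.
    - by move=> t tI Pt; rewrite (T t tI Pt).
  have n1 := conc _ _ _ _ E1 _ T1; have n2 := conc _ _ _ _ E2 _ T2.
  near=> e.
  have e0 : 0 < e by near: e; exact: nbhs_right_gt.
  have : `|period_integral (fun t => bump x e (P1 t) *
            (gamma (dot u (direction (Q1 t))) * enorm (Q1 t))) -
          gamma (dot u tau) * m1 e| <= eta * m1 e by near: e.
  have : `|period_integral (fun t => bump x e (P2 t) *
            (gamma (dot u (direction (Q2 t))) * enorm (Q2 t))) -
          gamma (dot u sigma) * m2 e| <= eta * m2 e by near: e.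
  rewrite (test u1 (bump_C0 x e0)) => h2 h1.
  set J := period_integral _ in h1 h2.
  rewrite (_ : _ - _ = (J - gamma (dot u sigma) * m2 e) -
    (J - gamma (dot u tau) * m1 e)); last ring.
  by rewrite (le_trans (ler_normB _ _))// addrC mulrDr lerD.
have sections (u : 'rV[R]_d) : enorm u = 1 -> gamma (dot u tau) = gamma (dot u sigma) /\
    exists2 eta, 0 < eta & forall p q, 0 < p + q ->
    `|gamma 1 * p - gamma (dot tau sigma) * q| <= eta * (p + q) -> p <> 0 /\ q <> 0.
  move=> u1; apply: (balanced_masses (g := gamma (dot tau sigma)) gamma1) => eta eta0.
  have := balance _ _ tau1 eta0; rewrite (dot_unit tau1) => b1.
  have := balance _ _ sigma1 eta0; rewrite (dot_unit sigma1) (dotC sigma) => b2.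
  have b3 := balance _ _ u1 eta0.
  near (0 : R)^'+ => e; exists (m1 e), (m2 e); split => //.
  - by split => //; apply: ltW.
  - by near: e.
  - by near: e.
  - by near: e.
split.
  apply/eqP/negPn/negP => /eqP ts.
  have w0 : tau - sigma <> 0 by move=> /eqP; rewrite subr_eq0 => /eqP.
  have u1 := enorm_direction w0.
  set a := 1 - dot tau sigma.
  have da : dot (tau - sigma) tau = a by rewrite dotBl (dot_unit tau1) dotC.
  have db : dot (tau - sigma) sigma = - a by rewrite dotBl (dot_unit sigma1) opprB.
  have n0 := enorm_gt0 w0.
  have a0 : a <> 0.
    move=> a0; apply: w0; apply: dot_eq0.
    by rewrite dotBr da db a0; ring.
  have [+ _] := sections _ u1.
  have tI := dot_unit_itv u1 tau1.
  have -> : dot (direction (tau - sigma)) sigma = - dot (direction (tau - sigma)) tau.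
    by rewrite /direction !dotZl da db mulrN.
  move=> /esym; apply: gamma_odd => //.
  rewrite /direction dotZl da => /eqP; rewrite mulf_eq0 invr_eq0 (gt_eqF n0) orFb => /eqP.
  exact: a0.
apply: contrapT => noP1.
have [_ [eta eta0 pos]] := sections _ tau1.
have m1z := mass_vanishes E1 (fun t tI Pt => noP1 (ex_intro2 _ _ t tI Pt)).
have := balance _ _ tau1 eta0; rewrite (dot_unit tau1) => b1.
near (0 : R)^'+ => e.
have [] := pos (m1 e) (m2 e) (m120 e); first by near: e.
by move=> m1e; exfalso; apply: m1e; near: e.
Unshelve. all: by end_near. Qed.

End TangentsAgree.

(** * Matching the points of the two curves *)

Section Isolation.
Context (R : realType) (d : nat).

(** Values other than c s are avoided by continuity; the component of c along q
    has nonzero derivative at s, so c leaves the value c s at once. *)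
Lemma regular_point_isolated (c : R -> 'rV[R]_d) (q : 'rV[R]_d) (s : R) (x : 'rV[R]_d) :
  is_derive s 1 c q -> q <> 0 -> \forall t \near s^', c t <> x.
Proof.
move=> dc q0; pose g t := dot (c t) q.
have /is_derive1_caratheodory [k [gE ck ks]] : is_derive s 1 g (dot q q).
  exact: is_derive_dot.
have k0 : 0 < k s by rewrite ks -enorm_sqr exprn_gt0// enorm_gt0.
have [csx|csx] := pselect (c s = x); last first.
  have cc : {for s, continuous c} by exact: is_derive_continuous dc.
  apply: nbhs_dnbhs; near=> t; apply/eqP; rewrite -subr_eq0.
  near: t; apply: (@cvgr_neq0 _ _ _ _ _ (fun t => c t - x) (c s - x)).
    have cx : {for s, continuous (fun=> x)} by exact: cst_continuous.
    exact: (cvgB cc cx).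
  by rewrite subr_eq0; apply/eqP.
have kp : \forall t \near s, 0 < k t by exact: (cvgr_gt (k s) ck).
near=> t => ctx.
have ts : t - s != 0 by rewrite subr_eq0; near: t; exact: nbhs_dnbhs_neq.
have := gE t; rewrite /g ctx -csx subrr => /esym/eqP.
rewrite mulf_eq0 (negbTE ts) orbF => /eqP kt0.
have : 0 < k t by near: t; exact: nbhs_dnbhs.
by rewrite kt0 ltxx.
Unshelve. all: by end_near. Qed.

Lemma near_avoids_finite (c : R -> 'rV[R]_d) (q : 'rV[R]_d) (s : R) (X : set 'rV[R]_d) :
  is_derive s 1 c q -> q <> 0 -> finite_set X -> \forall t \near s^', ~ X (c t).
Proof.
move=> dc q0 /finite_seqP[r ->].
have : \forall t \near s^', c t \notin r.
  elim: r => [|x r IH]; first by near=> t.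
  have xP := regular_point_isolated x dc q0.
  near=> t; rewrite inE negb_or; apply/andP; split; last by near: t.
  by apply/eqP; near: t.
by apply: filterS => t /negP.
Unshelve. all: by end_near. Qed.

Lemma period_interior_dense (s : R) (A : set R) : 0 <= s <= 2 * pi ->
  (\forall t \near s^', A t) -> exists2 t, 0 < t < 2 * pi & A t.
Proof.
move=> sI [e /= e0 eA]; have pi0 := pi_gt0 R.
have m0 : 0 < Num.min (e / 2) (pi / 2) by rewrite lt_min !divr_gt0.
have m1 : Num.min (e / 2) (pi / 2) <= e / 2 by rewrite ge_min lexx.
have m2 : Num.min (e / 2) (pi / 2) <= pi / 2 by rewrite ge_min lexx orbT.
move: (Num.min _ _) m0 m1 m2 => x x0 x1 x2.
have [sp|sp] := leP s pi.
  exists (s + x); first lra; apply: eA => /=; last by apply/eqP; lra.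
  by rewrite opprD addNKr normrN ger0_norm; lra.
exists (s - x); first lra; apply: eA => /=; last by apply/eqP; lra.
by rewrite opprB addrC subrK ger0_norm; lra.
Qed.

Lemma mismatch_open (P1 P2 D1 D2 : R -> 'rV[R]_d) (t s : R) :
  {for t, continuous P1} -> {for s, continuous P2} ->
  {for t, continuous D1} -> {for s, continuous D2} ->
  ~ (P1 t = P2 s /\ D1 t = D2 s) ->
  \forall t' \near t & z \near s, ~ (P1 t' = P2 z /\ D1 t' = D2 z).
Proof.
have sep (f g : R -> 'rV[R]_d) : {for t, continuous f} -> {for s, continuous g} ->
    f t <> g s -> \forall t' \near t & z \near s, f t' <> g z.
  move=> cf cg fg; have d0 : 0 < `|f t - g s| by rewrite normr_gt0 subr_eq0; apply/eqP.
  near=> t' z => /= e.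
  have h1 : `|f t - f t'| < `|f t - g s| / 2.
    by near: t'; apply: (@cvgr_dist_lt _ _ _ _ _ f (f t)) => //; rewrite divr_gt0.
  have h2 : `|g s - g z| < `|f t - g s| / 2.
    by near: z; apply: (@cvgr_dist_lt _ _ _ _ _ g (g s)) => //; rewrite divr_gt0.
  have : `|f t - g s| <= `|f t - f t'| + `|g s - g z|.
    rewrite (_ : f t - g s = (f t - f t') - (g s - g z)) ?ler_normB//.
    by rewrite e opprB addrA subrK.
  clear e; move: (`|f t - g s|) (`|f t - f t'|) (`|g s - g z|) h1 h2 => r p q h1 h2 h3.
  by clear -h1 h2 h3; lra.
move=> cP1 cP2 cD1 cD2 n.
have [Pts|Pts] := pselect (P1 t = P2 s); last first.
  by have := sep P1 P2 cP1 cP2 Pts; apply: filterS => -[t' z] /= m [/m].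
have Dts : D1 t <> D2 s by move=> Dts; apply: n.
by have := sep _ _ cD1 cD2 Dts; apply: filterS => -[t' z] /= m [_ /m].
Unshelve. all: by end_near. Qed.

End Isolation.

Section SelfIntersections.
Context (R : realType) (d : nat) (M : manifold1) (c P Q : R -> 'rV[R]_d) (U : set R).
Hypothesis E : regular_extension M c P Q U.

Lemma ext_pos_points t : points M t -> P t = c t.
Proof. by move=> /points_params/(ext_params E)/(ext_pos E). Qed.

Lemma ext_vel_points t : points M t -> Q t = c^`() t.
Proof. by move=> /points_params/(ext_params E)/(ext_vel E). Qed.

Lemma period_point (t : R) : 0 <= t <= 2 * pi ->
  exists t', [/\ points M t', P t' = P t & Q t' = Q t].
Proof.
move=> tI; have per := ext_periodic E; move: tI.
case: M per => per /andP[t0]; last by exists t; rewrite /points/= in_itv/= t0.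
rewrite le_eqVlt => /predU1P[->|t1]; last by exists t; rewrite /points/= in_itv/= t0.
exists 0; have [_ <- <-] := per erefl 0; rewrite add0r; split => //.
by rewrite /points/= in_itv/= lexx two_pi_gt0.
Qed.

Hypothesis T : finite_transverse_self_intersections M c.

Definition multiple_points : set 'rV[R]_d :=
  [set x | exists s t, [/\ points M s, points M t, s <> t, c s = x & c t = x]].

Lemma simple_point_velocity (s t : R) : 0 <= s <= 2 * pi -> 0 <= t <= 2 * pi ->
  ~ multiple_points (P s) -> P t = P s -> Q t = Q s.
Proof.
move=> /period_point[s' [Ks' Ps' <-]] /period_point[t' [Kt' Pt' <-]] + Pts.
rewrite -Ps' => nm; congr Q; apply: contrapT => ts; apply: nm.
by exists t', s'; rewrite -!ext_pos_points// Pt' Pts Ps'.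
Qed.

(** At a self-intersection the tangents are not even collinear, so position and
    direction together determine the parameter. *)
Lemma points_inj (s t : R) : points M s -> points M t -> P s = P t ->
  direction (Q s) = direction (Q t) -> s = t.
Proof.
move=> Ks Kt Pst Qst; apply: contrapT => st.
have [_ /(_ s t Ks Kt st)] := T.
rewrite -!ext_pos_points// -!ext_vel_points// => /(_ Pst).
move=> /(_ (enorm (Q s))^-1 (- (enorm (Q t))^-1)).
rewrite scaleNr -/(direction (Q s)) -/(direction (Q t)) Qst subrr => /(_ erefl)[/eqP + _].
by rewrite invr_eq0 (gt_eqF (enorm_gt0 (ext_vel_neq0 E s))).
Qed.

End SelfIntersections.

Section MatchExists.
Context (R : realType) (d : nat) (M : manifold1) (gamma : R -> R).
Hypothesis gammaC1 : C1_on `[(-1), 1] gamma.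
Hypothesis gamma1 : 0 < gamma 1.
Hypothesis gamma_odd : forall t : R, -1 <= t <= 1 -> t <> 0 -> gamma (- t) <> gamma t.

Context (c1 c2 P1 P2 Q1 Q2 : R -> 'rV[R]_d) (U1 U2 : set R).
Hypothesis E1 : regular_extension M c1 P1 Q1 U1.
Hypothesis E2 : regular_extension M c2 P2 Q2 U2.
Hypothesis T1 : finite_transverse_self_intersections M c1.
Hypothesis T2 : finite_transverse_self_intersections M c2.

Hypothesis test : forall (u : 'rV[R]_d) f, enorm u = 1 -> @C0 R _ f ->
  period_integral (fun t => f (P1 t) * (gamma (dot u (direction (Q1 t))) * enorm (Q1 t))) =
  period_integral (fun t => f (P2 t) * (gamma (dot u (direction (Q2 t))) * enorm (Q2 t))).

Lemma match_simple_point (s : R) : 0 <= s <= 2 * pi ->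
  ~ multiple_points M c1 (P2 s) -> ~ multiple_points M c2 (P2 s) ->
  exists2 t, 0 <= t <= 2 * pi & P1 t = P2 s /\ direction (Q1 t) = direction (Q2 s).
Proof.
move=> sI s1 s2; set x := P2 s; set sigma := direction (Q2 s).
have sigma1 : enorm sigma = 1 by rewrite enorm_direction//; exact: ext_vel_neq0 E2 s.
have Tsigma (t : R) : 0 <= t <= 2 * pi -> P2 t = x -> direction (Q2 t) = sigma.
  by move=> tI Pt; rewrite (simple_point_velocity E2 sI tI s2 Pt).
have inP2 : exists2 t, 0 <= t <= 2 * pi & P2 t = x by exists s.
have agree tau : enorm tau = 1 ->
    (forall t, 0 <= t <= 2 * pi -> P1 t = x -> direction (Q1 t) = tau) ->
    tau = sigma /\ exists2 t, 0 <= t <= 2 * pi & P1 t = x.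
  move=> tau1 Ttau.
  exact: (tangents_agree gammaC1 gamma1 gamma_odd E1 E2 test tau1 sigma1 Ttau Tsigma inP2).
have [t0 t0I Pt0] : exists2 t, 0 <= t <= 2 * pi & P1 t = x.
  apply: contrapT => noP1; have [|_ //] := agree sigma sigma1.
  by move=> t tI Pt; exfalso; apply: noP1; exists t.
exists t0 => //; split => //.
have [||//] := agree (direction (Q1 t0)).
  by rewrite enorm_direction//; exact: ext_vel_neq0 E1 t0.
by move=> t tI Pt; rewrite (simple_point_velocity E1 t0I tI)// ?Pt0.
Qed.

(** Simple points are dense among the parameters, and the set of pairs with the
    same position and direction is closed; so a parameter without match would,
    the period being compact, have a neighbourhood without matches. *)
Lemma match_exists (s : R) : 0 <= s <= 2 * pi ->
  exists2 t, 0 <= t <= 2 * pi & P1 t = P2 s /\ direction (Q1 t) = direction (Q2 s).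
Proof.
move=> sI; apply: contrapT => noMatch.
have cD (c P Q : R -> 'rV[R]_d) U (E : regular_extension M c P Q U) t :
      {for t, continuous (fun t => direction (Q t))}.
  by apply: continuous_direction; [exact: ext_cont_vel E t|exact: ext_vel_neq0 E t].
have far : \forall z \near s, `[0, 2 * pi] `<=`
    [set t | ~ (P1 t = P2 z /\ direction (Q1 t) = direction (Q2 z))].
  have [near_cover _] := @compact_near_coveringP R `[0, 2 * pi].
  apply: (near_cover (@segment_compact R 0 (2 * pi)) R (nbhs s)
    (fun z t =>
      ~ (P1 t = P2 z /\ direction (Q1 t) = direction (Q2 z)))) => t /=; rewrite in_itv/= => tI.
  have m : ~ (P1 t = P2 s /\ direction (Q1 t) = direction (Q2 s)).
    by move=> m; apply: noMatch; exists t.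
  exact: (mismatch_open (ext_cont_pos E1 t) (ext_cont_pos E2 s)
    (@cD _ _ _ _ E1 t) (@cD _ _ _ _ E2 s) m).
have Us : U2 s by apply: (ext_params E2); exact: params_period.
have good : \forall z \near s^', [/\ ~ multiple_points M c1 (P2 z), ~ multiple_points M c2 (P2 z) &
    `[0, 2 * pi] `<=` [set t | ~ (P1 t = P2 z /\ direction (Q1 t) = direction (Q2 z))]].
  have n0 := ext_vel_neq0 E2 s; have dc := ext_derive E2 Us.
  have g1 := near_avoids_finite dc n0 T1.1.
  have g2 := near_avoids_finite dc n0 T2.1.
  have U2s : \forall z \near s^', U2 z.
    by apply: nbhs_dnbhs; apply: open_nbhs_nbhs; split => //; exact: ext_open E2.
  near=> z; have P2z : P2 z = c2 z by apply: (ext_pos E2); near: z.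
  split; first by rewrite P2z; near: z.
    by rewrite P2z; near: z.
  by near: z; exact: nbhs_dnbhs.
have [z /andP[/ltW z0 /ltW z2pi] [z1 z2 z3]] := period_interior_dense sI good.
have zI : 0 <= z <= 2 * pi by rewrite z0.
have [t tI tz] := match_simple_point zI z1 z2.
by apply: (z3 t) => //=; rewrite in_itv.
Unshelve. all: by end_near. Qed.

End MatchExists.

(** * Arc length of matched curves *)

Section ScalarCalculus.
Context (R : realType).
Implicit Types (f g h F : R -> R) (s t a b : R).

(** The continuity of g selects a branch of the inverse of f near g s. *)
Lemma is_derive_implicit f g h s a b :
  is_derive (g s) 1 f a -> a != 0 -> is_derive s 1 h b -> {for s, continuous g} ->
  (\forall z \near s, f (g z) = h z) -> is_derive s 1 g (b / a).
Proof.
move=> /is_derive1_caratheodory[k [fE ck ka]] a0.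
move=> /is_derive1_caratheodory[m [hE cm mb]] cg fg.
have fgs : f (g s) = h s := nbhs_singleton fg.
have ckg : {for s, continuous (k \o g)} by apply: continuous_comp.
have cq : {for s, continuous (fun z => m z / k (g z))}.
  by apply: cvgM => //; apply: cvgV => //; rewrite ka.
apply/is_derive1_caratheodory.
exists (fun z => if z == s then b / a else (g z - g s) / (z - s)); split.
- move=> z; case: eqP => [->|/eqP zs]; first by rewrite !subrr mulr0.
  by rewrite divfK// subr_eq0.
- rewrite /prop_for /continuous_at eqxx -mb -ka; apply: cvg_trans cq.
  apply: near_eq_cvg; near=> z; case: eqP => [->//|/eqP zs].
  have k0 : k (g z) != 0.
    near: z; apply: (@cvgr_neq0 _ _ _ _ _ (k \o g) (k (g s)) ckg).
    by rewrite ka.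
  have zs0 : z - s != 0 by rewrite subr_eq0.
  have fgz : f (g z) = h z by near: z.
  apply: (mulIf zs0); rewrite divfK// mulrAC -hE -fgz -fgs fE.
  by rewrite mulrC mulKf.
- by rewrite eqxx.
Unshelve. all: by end_near. Qed.

Lemma derive0_constant f a b : (forall t, a < t < b -> is_derive t 1 f 0) ->
  forall s t, a < s < b -> a < t < b -> f s = f t.
Proof.
move=> df.
suff le_case : forall s t, s <= t -> a < s < b -> a < t < b -> f s = f t.
  move=> s t sI tI; have [st|/ltW st] := leP s t; first exact: le_case.
  by apply/esym; exact: le_case.
move=> s t st sI tI; have [] := @MVT_segment R f (fun=> 0) s t st.
- by move=> x; rewrite in_itv/= => xI; apply: df; lra.
- apply: continuous_in_subspaceT => x; rewrite inE/= in_itv/= => xI.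
  by apply: is_derive_continuous; apply: df; lra.
by move=> c _ /eqP; rewrite mul0r subr_eq0 => /eqP.
Qed.

Lemma ge0_derive_nondecreasing f F : (forall t, is_derive t 1 F (f t)) ->
  (forall t, 0 <= f t) -> {homo F : s t / s <= t}.
Proof.
move=> dF f0 s t st; have [] := @MVT_segment R F f s t st.
  by apply: continuous_subspaceT => x; exact: is_derive_continuous (dF x).
by move=> c _ /eqP; rewrite subr_eq => /eqP ->; rewrite lerDr mulr_ge0// subr_ge0.
Qed.

End ScalarCalculus.

Section MatchedArcLength.
Context (R : realType) (d : nat).
Context (P1 P2 Q1 Q2 : R -> 'rV[R]_d) (L1 L2 : R -> R).

Definition matched (s t : R) := P1 t = P2 s /\ direction (Q1 t) = direction (Q2 s).

Hypothesis cQ1 : continuous Q1.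
Hypothesis cQ2 : continuous Q2.
Hypothesis Q10 : forall t, Q1 t <> 0.
Hypothesis Q20 : forall t, Q2 t <> 0.
Hypothesis dP1 : forall t : R, 0 <= t <= 2 * pi -> is_derive t 1 P1 (Q1 t).
Hypothesis dP2 : forall t : R, 0 <= t <= 2 * pi -> is_derive t 1 P2 (Q2 t).
Hypothesis dL1 : forall t : R, is_derive t 1 L1 (enorm (Q1 t)).
Hypothesis dL2 : forall t : R, is_derive t 1 L2 (enorm (Q2 t)).
Hypothesis L10 : L1 0 = 0.
Hypothesis L20 : L2 0 = 0.
Hypothesis exists_match : forall s : R, 0 < s < 2 * pi ->
  exists2 t, 0 <= t <= 2 * pi & matched s t.
Hypothesis unique_match : forall s t t' : R, 0 < s < 2 * pi ->
  0 <= t <= 2 * pi -> 0 <= t' <= 2 * pi -> matched s t -> matched s t' -> t = t'.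

(** The match is continuous, since its graph is closed and its target compact.
    Differentiating P1 (t) = P2 (s) along the common tangent shows that it
    respects arc length infinitesimally, so the arc lengths of matched points
    differ by a constant; that constant places an interval of length L2 (2 pi)
    inside one of length L1 (2 pi). *)
Lemma matched_arc_length : exists a, [/\ 0 <= a, L2 (2 * pi) + a <= L1 (2 * pi) &
  forall s : R, 0 < s < 2 * pi ->
    exists t, [/\ 0 <= t <= 2 * pi, matched s t & L1 t = L2 s + a]].
Proof.
have [phi phiP] : {phi : R -> R & forall s : R, 0 < s < 2 * pi ->
    0 <= phi s <= 2 * pi /\ matched s (phi s)}.
  apply: (@choice R R (fun s t => 0 < s < 2 * pi -> 0 <= t <= 2 * pi /\ matched s t)) => s.
  have [sI|sI] := pselect (0 < s < 2 * pi); last by exists 0.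
  by have [t tI st] := exists_match sI; exists t.
have cP2 (t : R) : 0 <= t <= 2 * pi -> {for t, continuous P2}.
  by move=> /dP2; exact: is_derive_continuous.
have cP1 (t : R) : 0 <= t <= 2 * pi -> {for t, continuous P1}.
  by move=> /dP1; exact: is_derive_continuous.
have oo_cc (s : R) : 0 < s < 2 * pi -> 0 <= s <= 2 * pi by move=> /andP[/ltW-> /ltW->].
have near_oo (s : R) : 0 < s < 2 * pi -> \forall z \near s, 0 < z < 2 * pi.
  move=> /andP[s0 s1]; near=> z; apply/andP; split; near: z.
    exact: lt_nbhsr.
  exact: lt_nbhsl.
have cphi (s : R) : 0 < s < 2 * pi -> {for s, continuous phi}.
  move=> sI; apply/cvgrPdist_lt => e e0.
  have : \forall z \near s, `[0, 2 * pi] `<=` [set t | matched z t -> `|phi s - t| < e].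
    have [near_cover _] := @compact_near_coveringP R `[0, 2 * pi].
    apply: (near_cover (@segment_compact R 0 (2 * pi)) R (nbhs s)
      (fun z t => matched z t -> `|phi s - t| < e)) => t /=; rewrite in_itv/= => tI.
    have [mt|mt] := pselect (matched s t).
      near=> t' z => /= _; rewrite (unique_match sI (phiP s sI).1 tI (phiP s sI).2 mt).
      by near: t'; exists e.
    have := mismatch_open (cP1 t tI) (cP2 s (oo_cc s sI))
      (continuous_direction (@cQ1 t) (@Q10 t)) (continuous_direction (@cQ2 s) (@Q20 s)) mt.
    by apply: filterS => -[t' z] /= n /n.
  move=> closed; near=> z.
  have zI : 0 < z < 2 * pi by near: z; exact: near_oo.
  have K : `[0, 2 * pi] `<=` [set t | matched z t -> `|phi s - t| < e] by near: z.
  by have [phizI mz] := phiP z zI; apply: (K (phi z)) => //=; rewrite in_itv.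
have dphi (s : R) : 0 < s < 2 * pi -> is_derive s 1 (fun z => L1 (phi z) - L2 z) 0.
  move=> sI; have [phisI [_ Ds]] := phiP s sI.
  set T := direction (Q1 (phi s)).
  have n0 : enorm (Q1 (phi s)) != 0 by rewrite gt_eqF// enorm_gt0.
  have df : is_derive (phi s) 1 (fun t => dot (P1 t) T) (enorm (Q1 (phi s))).
    by rewrite -[enorm _](dot_direction (@Q10 _)); apply: is_derive_dot; exact: dP1.
  have dh : is_derive s 1 (fun t => dot (P2 t) T) (enorm (Q2 s)).
    rewrite -[enorm _](dot_direction (@Q20 _)) -Ds; apply: is_derive_dot.
    exact: dP2 (oo_cc s sI).
  have dg : is_derive s 1 phi (enorm (Q2 s) / enorm (Q1 (phi s))).
    apply: (is_derive_implicit df n0 dh (cphi s sI)).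
    near=> z; have zI : 0 < z < 2 * pi by near: z; exact: near_oo.
    by have [_ [-> _]] := phiP z zI.
  have dL := is_derive1_comp (dL1 (phi s)) dg.
  have -> : 0 = enorm (Q1 (phi s)) * (enorm (Q2 s) / enorm (Q1 (phi s))) - enorm (Q2 s).
    by rewrite mulrCA mulfV// mulr1 subrr.
  exact: is_deriveB dL (dL2 s).
have pi0 := pi_gt0 R; have piI : 0 < (pi : R) < 2 * pi by lra.
have cst (s : R) (sI : 0 < s < 2 * pi) := derive0_constant dphi sI piI.
pose a := L1 (phi pi) - L2 pi.
have La (s : R) : 0 < s < 2 * pi -> L1 (phi s) = L2 s + a.
  by move=> /cst; rewrite /a => <-; rewrite addrC subrK.
have mono1 := ge0_derive_nondecreasing dL1 (fun t => enorm_ge0 (Q1 t)).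
have cL2 t := is_derive_continuous (dL2 t).
exists a; split.
- rewrite leNgt; apply/negP => a0.
  have [||s sI] := @period_interior_dense R 0 (fun s => L2 s < - a); first lra.
  - by apply: nbhs_dnbhs; apply: (cvgr_lt (L2 0) (cL2 0)); rewrite L20 oppr_gt0.
  have [/andP[/mono1 + _] _] := phiP s sI.
  by rewrite L10 La//; lra.
- rewrite leNgt; apply/negP => a0.
  have [||s sI] := @period_interior_dense R (2 * pi) (fun s => L1 (2 * pi) - a < L2 s); first lra.
  - by apply: nbhs_dnbhs; apply: (cvgr_gt (L2 (2 * pi)) (cL2 (2 * pi))); lra.
  have [/andP[_ /mono1 +] _] := phiP s sI.
  by rewrite La//; lra.
- by move=> s sI; exists (phi s); have [? ?] := phiP s sI; split => //; exact: La.
Unshelve. all: by end_near. Qed.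

End MatchedArcLength.

(** * Smoothness *)

Section Differentiability.
Context (R : realType).

(** On an open set, this says that the first n iterated derivatives exist; the
    derivatives are named by witnesses so that only their values on U matter. *)
Fixpoint times_derivable (V : normedModType R) n (U : set R) (f : R -> V) : Prop :=
  if n is n'.+1 then
    exists g, (forall t, U t -> is_derive t 1 f (g t)) /\ times_derivable n' U g
  else True.

Lemma times_derivable_pred (V : normedModType R) n U (f : R -> V) :
  times_derivable n.+1 U f -> times_derivable n U f.
Proof.
elim: n f => [//|n IH] f [g [dg Dg]].
by exists g; split => //; exact: IH.
Qed.

Lemma eq_times_derivable (V : normedModType R) n U (f g : R -> V) : open U ->
  (forall t, U t -> f t = g t) -> times_derivable n U f -> times_derivable n U g.
Proof.
move=> oU fg; case: n => [//|n] [h [dh Dh]]; exists h; split => // t Ut.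
apply: near_eq_is_derive (dh t Ut).
by apply: filterS (open_nbhs_nbhs (conj oU Ut)); exact: fg.
Qed.

Lemma times_derivable_subset (V : normedModType R) n U W (f : R -> V) : W `<=` U ->
  times_derivable n U f -> times_derivable n W f.
Proof.
move=> WU; elim: n f => [//|n IH] f [h [dh Dh]].
by exists h; split; [move=> t /WU; exact: dh|exact: IH].
Qed.

Lemma times_derivableP (V : normedModType R) U (f : R -> V) : open U ->
  (forall n t, U t -> derivable f^`(n) t 1) <-> (forall n, times_derivable n U f).
Proof.
move=> oU; split=> [df n|Df n].
  elim: n f df => [//|n IH] f df; exists f^`(); split.
    by move=> t Ut; rewrite derive1E; apply: derivableP; exact: (df 0%N).
  by apply: IH => k t Ut; rewrite -derive1Sn; exact: df.
elim: n f Df => [|n IH] f Df t Ut.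
  by rewrite derive1n0; have [g [dg _]] := Df 1%N; have [] := dg t Ut.
rewrite derive1Sn; apply: IH Ut => k; have [g [dg Dg]] := Df k.+1.
apply: eq_times_derivable Dg => // s Us.
by rewrite derive1E; have [_ ->] := dg s Us.
Qed.

Implicit Types (f g : R -> R).

Lemma times_derivable_cst n U (k : R) : times_derivable n U (fun=> k).
Proof.
elim: n k => [//|n IH] k; exists (fun=> 0); split => // t _.
exact: is_derive_cst.
Qed.

Lemma times_derivableD n U f g : times_derivable n U f -> times_derivable n U g ->
  times_derivable n U (fun t => f t + g t).
Proof.
elim: n f g => [//|n IH] f g [f' [df Df]] [g' [dg Dg]].
exists (fun t => f' t + g' t); split; last exact: IH.
by move=> t Ut; exact: is_deriveD (df t Ut) (dg t Ut).
Qed.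

Lemma times_derivableM n U f g : times_derivable n U f -> times_derivable n U g ->
  times_derivable n U (fun t => f t * g t).
Proof.
elim: n f g => [//|n IH] f g nf ng.
have nf1 := times_derivable_pred nf; have ng1 := times_derivable_pred ng.
case: nf ng => [f' [df Df]] [g' [dg Dg]].
exists (fun t => f t * g' t + g t * f' t); split.
  by move=> t Ut; exact: is_deriveM (df t Ut) (dg t Ut).
by apply: times_derivableD; exact: IH.
Qed.

Lemma times_derivableV n U f : (forall t, U t -> f t != 0) ->
  times_derivable n U f -> times_derivable n U (fun t => (f t)^-1).
Proof.
move=> f0; elim: n => [//|n IH] nf; have /IH Vn := times_derivable_pred nf.
case: nf => [f' [df Df]].
exists (fun t => -1 * ((f t)^-1 * (f t)^-1 * f' t)); split.
  move=> t Ut; have := is_deriveV (f0 t Ut) (df t Ut).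
  rewrite (_ : - (f t) ^- 2 *: f' t = -1 * ((f t)^-1 * (f t)^-1 * f' t))//.
  by rewrite /GRing.scale/= expr2 invfM; ring.
apply: times_derivableM; first exact: times_derivable_cst.
by apply: times_derivableM => //; exact: times_derivableM.
Qed.

Lemma times_derivable_comp n U W f g : (forall t, U t -> W (g t)) ->
  times_derivable n W f -> times_derivable n U g -> times_derivable n U (fun t => f (g t)).
Proof.
move=> UW; elim: n f => [//|n IH] f [f' [df Df]] ng.
have ng1 := times_derivable_pred ng; case: ng => [g' [dg Dg]].
exists (fun t => f' (g t) * g' t); split.
  by move=> t Ut; exact: is_derive1_comp (df _ (UW t Ut)) (dg t Ut).
by apply: times_derivableM => //; exact: IH.
Qed.

Lemma times_derivable_dot d n U (p q : R -> 'rV[R]_d) :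
  times_derivable n U p -> times_derivable n U q ->
  times_derivable n U (fun t => dot (p t) (q t)).
Proof.
elim: n p q => [//|n IH] p q np nq.
have np1 := times_derivable_pred np; have nq1 := times_derivable_pred nq.
case: np nq => [p' [dp Dp]] [q' [dq Dq]].
exists (fun t => dot (p' t) (q t) + dot (p t) (q' t)); split.
  by move=> t Ut; exact: is_derive_dot2 (dp t Ut) (dq t Ut).
by apply: times_derivableD; exact: IH.
Qed.

(** The derivative of N = sqrt (Q . Q) is (Q' . Q) / N, where N occurs with one
    derivative less. *)
Lemma times_derivable_enorm d n U (Q : R -> 'rV[R]_d) : (forall t, U t -> Q t <> 0) ->
  times_derivable n U Q -> times_derivable n U (fun t => enorm (Q t)).
Proof.
move=> Q0; elim: n => [//|n IH] nQ; have nQ1 := times_derivable_pred nQ.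
have nN := IH nQ1; case: nQ => [Q' [dQ DQ]].
exists (fun t => dot (Q' t) (Q t) * (enorm (Q t))^-1); split.
  move=> t Ut; have N0 := enorm_gt0 (Q0 t Ut).
  have dd := is_derive_dot2 (dQ t Ut) (dQ t Ut).
  have dsq : 0 < dot (Q t) (Q t) by rewrite -enorm_sqr exprn_gt0.
  have := is_derive1_comp (is_derive1_sqrt dsq) dd.
  rewrite (_ : _ * (_ + _) = dot (Q' t) (Q t) * (enorm (Q t))^-1)//.
  by rewrite (dotC (Q t)) -/(enorm (Q t)); field; rewrite gt_eqF.
apply: times_derivableM; first exact: times_derivable_dot.
by apply: times_derivableV => // t Ut; rewrite gt_eqF// enorm_gt0//; exact: Q0.
Qed.

(** The equation phi' = v2 / v1 (phi) gives phi one derivative more than phi has,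
    as long as v1 and v2 are smooth. *)
Lemma smooth_change_of_speed (U1 U2 : set R) (v1 v2 phi : R -> R) :
  open U1 -> open U2 -> (forall t, v1 t != 0) ->
  (forall n, times_derivable n U1 v1) -> (forall n, times_derivable n U2 v2) ->
  (forall t : R, is_derive t 1 phi (v2 t / v1 (phi t))) ->
  forall A : set R, A `<=` U2 -> (forall t, A t -> U1 (phi t)) -> smooth_on A phi.
Proof.
move=> o1 o2 v10 s1 s2 dphi A AU2 AU1.
have cphi : continuous phi.
  by move=> t; exact: is_derive_continuous (dphi t).
have oW : open (U2 `&` phi @^-1` U1).
  by apply: openI => //; apply: open_comp => // t _; exact: cphi.
exists (U2 `&` phi @^-1` U1); split => //.
  by move=> t At; split; [exact: AU2|exact: AU1].
apply/(times_derivableP _ oW); elim=> [//|n IH].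
exists (fun t => v2 t * (v1 (phi t))^-1); split; first by move=> t _; exact: dphi.
apply: times_derivableM; first by apply: times_derivable_subset (s2 n) => t [].
apply: times_derivableV => //.
by apply: times_derivable_comp (s1 n) IH => t [].
Qed.

End Differentiability.

(** * The inverse of an arc length *)

Section InverseArcLength.
Context (R : realType) (v L : R -> R) (m : R).
Hypothesis m0 : 0 < m.
Hypothesis mv : forall t, m <= v t.
Hypothesis dL : forall t : R, is_derive t 1 L (v t).

Lemma arc_length_lower_bound (s t : R) : s <= t -> m * (t - s) <= L t - L s.
Proof.
move=> st; have [] := @MVT_segment R L v s t st.
  by apply: continuous_subspaceT => x; exact: is_derive_continuous (dL x).
by move=> c _ ->; rewrite ler_wpM2r ?subr_ge0.
Qed.

Lemma ltr_arc_length (s t : R) : s < t -> L s < L t.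
Proof.
move=> st; rewrite -subr_gt0; apply: lt_le_trans (arc_length_lower_bound (ltW st)).
by rewrite mulr_gt0// subr_gt0.
Qed.

Lemma ler_arc_length (s t : R) : (L s <= L t) = (s <= t).
Proof.
have [st|ts] := leP s t.
  by move: st; rewrite le_eqVlt => /predU1P[->|/ltr_arc_length/ltW ->//]; rewrite lexx.
by apply/negbTE; rewrite -ltNge ltr_arc_length.
Qed.

Lemma arc_length_inj (s t : R) : L s = L t -> s = t.
Proof. by move=> st; apply/eqP; rewrite eq_le -(ler_arc_length s) -(ler_arc_length t) st lexx. Qed.

Lemma inverse_arc_length :
  exists psi : R -> R, [/\ forall y, L (psi y) = y, forall t, psi (L t) = t & continuous psi].
Proof.
have surj (y : R) : exists t, L t = y.
  pose b := `|y - L 0| / m + 1.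
  have b0 : 0 < b by rewrite ltr_pwDr// divr_ge0// ltW.
  have mb : `|y - L 0| <= m * b.
    by rewrite mulrDr mulrCA mulfV ?gt_eqF// !mulr1 lerDl ltW.
  have h1 := arc_length_lower_bound (ltW b0); rewrite subr0 in h1.
  have nb0 : - b <= 0 by lra.
  have h2 := arc_length_lower_bound nb0; rewrite sub0r opprK in h2.
  rewrite ler_norml in mb.
  have bb : - b <= b by lra.
  have := @IVT R L (- b) b y bb.
  case; last by move=> c _ Lc; exists c.
    by apply: continuous_subspaceT => x; exact: is_derive_continuous (dL x).
  by rewrite ge_min le_max; apply/andP; split; apply/orP; [left|right]; lra.
have [psi Lpsi] : {psi : R -> R & forall y, L (psi y) = y}.
  exact: (@choice R R (fun y t => L t = y)).
have psiL t : psi (L t) = t by apply: arc_length_inj; rewrite Lpsi.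
exists psi; split => // y; apply/cvgrPdist_lt => e e0.
near=> z.
have : `|y - z| < m * e by near: z; exists (m * e) => //; exact: mulr_gt0.
suff lip : m * `|psi y - psi z| <= `|y - z|.
  by move=> yz; rewrite -(ltr_pM2l m0); exact: le_lt_trans lip yz.
have dist (s t : R) : s <= t -> m * `|t - s| <= `|L t - L s|.
  move=> st; rewrite ger0_norm ?subr_ge0//.
  exact: le_trans (arc_length_lower_bound st) (ler_norm _).
have [/dist|/ltW/dist] := leP (psi z) (psi y); rewrite !Lpsi//.
by rewrite distrC (distrC z).
Unshelve. all: by end_near. Qed.

Lemma arc_length_periodic (p : R) : (forall t, v (t + p) = v t) ->
  forall t, L (t + p) = L t + (L p - L 0).
Proof.
move=> vp t.
have d0 (s : R) : is_derive s 1 (fun s => L (s + p) - L s) 0.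
  have d1 : is_derive s 1 (fun s => s + p) 1.
    by have := is_deriveD (is_derive_id s 1) (is_derive_cst p s 1); rewrite addr0.
  have := is_deriveB (@is_derive1_comp _ L (fun s => s + p) s _ _ (dL (s + p)) d1) (dL s).
  by rewrite mulr1 vp subrr.
have := is_derive_0_is_cst t 0 d0; rewrite add0r => <-; ring.
Qed.

End InverseArcLength.

(** * The change of parameter *)

Section MatchedCurves.
Context (R : realType) (d : nat) (P1 P2 Q1 Q2 : R -> 'rV[R]_d).

Hypothesis cQ1 : continuous Q1.
Hypothesis cQ2 : continuous Q2.
Hypothesis speed1 : exists2 m, 0 < m & forall t, m <= enorm (Q1 t).
Hypothesis speed2 : exists2 m, 0 < m & forall t, m <= enorm (Q2 t).
Hypothesis dP1 : forall t : R, 0 <= t <= 2 * pi -> is_derive t 1 P1 (Q1 t).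
Hypothesis dP2 : forall t : R, 0 <= t <= 2 * pi -> is_derive t 1 P2 (Q2 t).
Notation matched12 := (matched P1 P2 Q1 Q2).
Notation matched21 := (matched P2 P1 Q2 Q1).
Hypothesis exists12 : forall s : R, 0 < s < 2 * pi ->
  exists2 t, 0 <= t <= 2 * pi & matched12 s t.
Hypothesis exists21 : forall t : R, 0 < t < 2 * pi ->
  exists2 s, 0 <= s <= 2 * pi & matched21 t s.
Hypothesis unique12 : forall s t t' : R, 0 < s < 2 * pi ->
  0 <= t <= 2 * pi -> 0 <= t' <= 2 * pi -> matched12 s t -> matched12 s t' -> t = t'.
Hypothesis unique21 : forall t s s' : R, 0 < t < 2 * pi ->
  0 <= s <= 2 * pi -> 0 <= s' <= 2 * pi -> matched21 t s -> matched21 t s' -> s = s'.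

(** phi and theta are the two changes of parameter that preserve arc length from
    the origin.  A translation embeds the arc length interval of each curve
    into that of the other, so the lengths are equal, both translations are
    trivial, and phi and theta match points. *)
Lemma matched_reparametrization : exists phi theta : R -> R,
  [/\ cancel phi theta, cancel theta phi,
      forall t : R, is_derive t 1 phi (enorm (Q2 t) / enorm (Q1 (phi t))),
      forall t : R, is_derive t 1 theta (enorm (Q1 t) / enorm (Q2 (theta t))) &
      [/\ forall s : R, 0 <= s <= 2 * pi -> 0 <= phi s <= 2 * pi /\ P1 (phi s) = P2 s,
          forall t : R, 0 <= t <= 2 * pi -> 0 <= theta t <= 2 * pi &
          (forall t, Q1 (t + 2 * pi) = Q1 t) -> (forall t, Q2 (t + 2 * pi) = Q2 t) ->
          forall t, phi (t + 2 * pi) = phi t + 2 * pi /\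
                    theta (t + 2 * pi) = theta t + 2 * pi]].
Proof.
have [m1 m10 mv1] := speed1; have [m2 m20 mv2] := speed2.
have neq0 (Q : R -> 'rV[R]_d) m : 0 < m -> (forall t, m <= enorm (Q t)) -> forall t, Q t <> 0.
  move=> m0 mQ t Qt; have := mQ t.
  by rewrite Qt enorm0; lra.
have Q10 := neq0 _ _ m10 mv1; have Q20 := neq0 _ _ m20 mv2.
have cv (Q : R -> 'rV[R]_d) : continuous Q -> continuous (fun t => enorm (Q t)).
  by move=> cQ t; exact: continuous_enorm (cQ t).
have [L1 [L10 dL1]] := primitive_exists (cv _ cQ1).
have [L2 [L20 dL2]] := primitive_exists (cv _ cQ2).
have [a [a0 al Ha]] := matched_arc_length cQ1 cQ2 Q10 Q20 dP1 dP2 dL1 dL2 L10 L20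
  exists12 unique12.
have [b [b0 bl _]] := matched_arc_length cQ2 cQ1 Q20 Q10 dP2 dP1 dL2 dL1 L20 L10
  exists21 unique21.
have az : a = 0 by lra.
have l12 : L1 (2 * pi) = L2 (2 * pi) by lra.
have [psi1 [K1 K1' cpsi1]] := inverse_arc_length m10 mv1 dL1.
have [psi2 [K2 K2' cpsi2]] := inverse_arc_length m20 mv2 dL2.
have le1 := ler_arc_length m10 mv1 dL1; have le2 := ler_arc_length m20 mv2 dL2.
have cL1 t := is_derive_continuous (dL1 t).
have cL2 t := is_derive_continuous (dL2 t).
have cphi (t : R) : {for t, continuous (psi1 \o L2)}.
  by apply: continuous_comp; [exact: cL2|exact: cpsi1].
have ctheta (t : R) : {for t, continuous (psi2 \o L1)}.
  by apply: continuous_comp; [exact: cL1|exact: cpsi2].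
have n1 t : enorm (Q1 t) != 0 by rewrite gt_eqF// enorm_gt0.
have n2 t : enorm (Q2 t) != 0 by rewrite gt_eqF// enorm_gt0.
have phiI (s : R) : 0 <= s <= 2 * pi -> 0 <= psi1 (L2 s) <= 2 * pi.
  by move=> sI; rewrite -(le1 0) -(le1 (psi1 _)) K1 L10 -L20 l12 !le2.
have thetaI (s : R) : 0 <= s <= 2 * pi -> 0 <= psi2 (L1 s) <= 2 * pi.
  by move=> sI; rewrite -(le2 0) -(le2 (psi2 _)) K2 L20 -L10 -l12 !le1.
exists (psi1 \o L2), (psi2 \o L1); split.
- by move=> t /=; rewrite K1 K2'.
- by move=> t /=; rewrite K2 K1'.
- move=> t; apply: (is_derive_implicit (dL1 _) (n1 _) (dL2 t) (cphi t)).
  by near=> z => /=; rewrite K1.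
- move=> t; apply: (is_derive_implicit (dL2 _) (n2 _) (dL1 t) (ctheta t)).
  by near=> z => /=; rewrite K2.
split.
- move=> s sI; split; first exact: phiI.
  apply: contrapT => neq.
  have cP1phi : {for s, continuous (fun z => P1 (psi1 (L2 z)))}.
    apply: (@continuous_comp _ _ _ (psi1 \o L2) P1); first exact: cphi.
    exact: (is_derive_continuous (dP1 (phiI s sI))).
  have cP2 := is_derive_continuous (dP2 sI).
  have : \forall z \near s^', P1 (psi1 (L2 z)) <> P2 z.
    apply: nbhs_dnbhs; near=> z; apply/eqP; rewrite -subr_eq0; near: z.
    apply: (@cvgr_neq0 _ _ _ _ _ (fun z => P1 (psi1 (L2 z)) - P2 z)
      (P1 (psi1 (L2 s)) - P2 s)); first exact: (cvgB cP1phi cP2).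
    by rewrite subr_eq0; apply/eqP.
  move=> /(period_interior_dense sI)[z zI]; apply.
  have [t [_ [Pt _] Lt]] := Ha z zI.
  by rewrite -Pt; congr P1; rewrite -[t]K1' Lt az addr0.
- exact: thetaI.
move=> per1 per2 t.
have v1 s : enorm (Q1 (s + 2 * pi)) = enorm (Q1 s) by rewrite per1.
have v2 s : enorm (Q2 (s + 2 * pi)) = enorm (Q2 s) by rewrite per2.
have p1 := arc_length_periodic dL1 v1; have p2 := arc_length_periodic dL2 v2.
split => /=.
  by rewrite -[RHS]K1' p1 K1 p2 l12 L10 L20.
by rewrite -[RHS]K2' p2 K2 p1 l12 L10 L20.
Unshelve. all: by end_near. Qed.

End MatchedCurves.

Section Periodicity.
Context (R : realType).

Lemma period_reduce (t : R) : exists k : int, 0 <= t - 2 * pi * k%:~R < 2 * pi.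
Proof.
have p0 := two_pi_gt0 R; exists (Num.floor (t / (2 * pi))).
have := floor_le_tmp (t / (2 * pi)); have := lt_succ_floor (t / (2 * pi)).
rewrite ler_pdivlMr// ltr_pdivrMr// intrD mulrDl mul1r.
by move: (_%:~R) => x; rewrite (mulrC x); lra.
Qed.

Lemma periodic_int (T : Type) (f : R -> T) (p : R) : (forall t, f (t + p) = f t) ->
  forall (k : int) t, f (t + p * k%:~R) = f t.
Proof.
move=> fp; have fn (n : nat) t : f (t + p * n%:R) = f t.
  elim: n t => [|n IH] t; first by rewrite mulr0 addr0.
  by rewrite -addn1 natrD mulrDr mulr1 addrA fp IH.
case=> n t; first exact: fn.
by rewrite NegzE mulrNz mulrN -[in RHS](subrK (p * n.+1%:R) t) fn.
Qed.

End Periodicity.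

Section ImmersionExtension.
Context (R : realType) (d : nat).

Lemma enorm_lower_bound (Q : R -> 'rV[R]_d) (a b : R) : a <= b ->
  continuous Q -> (forall t, Q t <> 0) ->
  (forall t, exists2 s, a <= s <= b & Q s = Q t) ->
  exists2 m, 0 < m & forall t, m <= enorm (Q t).
Proof.
move=> ab cQ Q0 red.
have [|s sI min] := @EVT_min R (fun t => enorm (Q t)) a b ab.
  by apply: continuous_subspaceT => t; exact: continuous_enorm (cQ t).
exists (enorm (Q s)); first exact: enorm_gt0.
by move=> t; have [r rI <-] := red t; apply: min; rewrite in_itv.
Qed.

(** A curve on the segment is immersed on some [- e, 2 pi + e]; r retracts the line
    onto this interval. *)
Lemma immersion_extension (M : manifold1) (c : R -> 'rV[R]_d) : immersion M c ->
  exists P Q U, regular_extension M c P Q U.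
Proof.
move=> [[[U0 [oU0 U0M sm]] +] c'0]; have p0 := two_pi_gt0 R.
have dc t : U0 t -> is_derive t 1 c (c^`() t).
  by move=> Ut; rewrite derive1E; apply: derivableP; exact: (sm 0%N t Ut).
have cc t : U0 t -> {for t, continuous c} by move=> /dc; exact: is_derive_continuous.
have cc' t : U0 t -> {for t, continuous c^`()}.
  move=> Ut; have := sm 1%N t Ut.
  by rewrite derive1n1 => /derivable1_diffP/differentiable_continuous.
case: M U0M c'0 => /= U0M c'0 per.
- have U0T t : U0 t by exact: U0M.
  have per' t : c^`() (t + 2 * pi) = c^`() t.
    rewrite /derive1 /=; congr (lim _).
    rewrite (_ : (fun h => _) = (fun h : R => h^-1 *: (c (h + t) - c t)))//.
    by apply/funext => h; rewrite addrA !per.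
  have red t : exists2 s, 0 <= s <= 2 * pi & c^`() s = c^`() t.
    have [k kI] := period_reduce t; exists (t - 2 * pi * k%:~R); first lra.
    by rewrite -[in RHS](subrK (2 * pi * k%:~R) t) (periodic_int per').
  exists c, c^`(), setT; split => //.
  + exact: openT.
  + by move=> t; apply: cc.
  + by move=> t; apply: cc'.
  + apply: enorm_lower_bound (ltW p0) _ _ red; first by move=> t; apply: cc'.
    by move=> t; exact: c'0.
  + by move=> t _; exact: dc.
  + by move=> n t _; exact: sm.
have good t : 0 <= t <= 2 * pi -> \forall s \near t, U0 s /\ c^`() s <> 0.
  move=> tI; have Ut : U0 t by apply: U0M; rewrite /= in_itv.
  near=> s; split; near: s; first exact: open_nbhs_nbhs.
  near=> s; apply/eqP; near: s; apply: (@cvgr_neq0 _ _ _ _ _ c^`() (c^`() t) (cc' t Ut)).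
  by apply/eqP; apply: c'0; rewrite /= in_itv.
have goodE (t : R) : 0 <= t <= 2 * pi ->
    exists2 e : R, 0 < e & forall s, `|t - s| < e -> U0 s /\ c^`() s <> 0.
  by move=> /good[e /= e0 he]; exists e.
have [|e0 e00 he0] := goodE 0; first lra.
have [|e1 e10 he1] := goodE (2 * pi); first lra.
pose e := Num.min e0 e1 / 2.
have [e_gt0 ee0 ee1] : [/\ 0 < e, e < e0 & e < e1].
  rewrite /e; case: (leP e0 e1) => ?; split; lra.
clearbody e; pose r (t : R) := Num.max (- e) (Num.min t (2 * pi + e)).
have rI t : - e <= r t <= 2 * pi + e.
  by rewrite /r le_max lexx/= ge_max ge_min lexx orbT andbT; lra.
have rE t : - e <= t <= 2 * pi + e -> r t = t.
  by move=> /andP[t0 t1]; rewrite /r min_l// max_r.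
have cr : continuous r.
  move=> t; have ck (k : R) : {for t, continuous (fun _ : R => k)} by exact: cst_continuous.
  have cid : {for t, continuous (fun s : R => s)} by exact: cvg_id.
  exact: (continuous_max (ck _) (continuous_min cid (ck _))).
have goodI t : - e <= t <= 2 * pi + e -> U0 t /\ c^`() t <> 0.
  move=> tI; have [t0|t0] := ltP t 0.
    by apply: he0; rewrite /= sub0r normrN ltr0_norm//; lra.
  have [t1|t1] := leP t (2 * pi); last first.
    by apply: he1; rewrite /= ltr0_norm; lra.
  have tK : params segment t by rewrite /= in_itv/= t0.
  by split; [exact: U0M|exact: c'0].
exists (c \o r), (c^`() \o r), `]- e, 2 * pi + e[%classic.
have rU t : `]- e, 2 * pi + e[%classic t -> r t = t.
  by rewrite /= in_itv/= => /andP[/ltW t0 /ltW t1]; apply: rE; rewrite t0.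
have U0U t : `]- e, 2 * pi + e[%classic t -> U0 t.
  by move=> Ut; rewrite -(rU t Ut); have [] := goodI _ (rI t).
have cQ : continuous (c^`() \o r).
  by move=> t; apply: continuous_comp; [exact: cr|apply: cc'; have [] := goodI _ (rI t)].
split => //.
- by move=> t /=; rewrite !in_itv/= => /andP[t0 t1]; apply/andP; lra.
- by move=> t; apply: continuous_comp; [exact: cr|apply: cc; have [] := goodI _ (rI t)].
- apply: (@enorm_lower_bound _ (- e) (2 * pi + e)) => //; first lra.
    by move=> t; have [] := goodI _ (rI t).
  by move=> t; exists (r t) => //=; rewrite rE.
- by move=> t Ut /=; rewrite rU.
- by move=> t Ut /=; rewrite rU.
- by move=> t Ut /=; rewrite (rU t Ut); exact: dc (U0U t Ut).
- by move=> n t /U0U; exact: sm.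
Unshelve. all: by end_near. Qed.

End ImmersionExtension.

Section Reparametrization.
Context (R : realType) (d : nat) (M : manifold1).
Context (c1 c2 P1 P2 Q1 Q2 : R -> 'rV[R]_d) (U1 U2 : set R).
Hypothesis E1 : regular_extension M c1 P1 Q1 U1.
Hypothesis E2 : regular_extension M c2 P2 Q2 U2.

Lemma ext_pos_derive c P Q U (E : regular_extension M c P Q U) (t : R) : U t ->
  is_derive t 1 P (Q t : 'rV[R]_d).
Proof.
move=> Ut; apply: near_eq_is_derive (ext_derive E Ut).
apply: filterS (open_nbhs_nbhs (conj (ext_open E) Ut)) => s Us.
by rewrite (ext_pos E Us).
Qed.

Lemma smooth_speed (c P Q : R -> 'rV[R]_d) U (E : regular_extension M c P Q U) n :
  times_derivable n U (fun t => enorm (Q t)).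
Proof.
apply: times_derivable_enorm; first by move=> t _; exact: ext_vel_neq0 E t.
apply: (@eq_times_derivable _ _ _ _ c^`()); first exact: ext_open E.
  by move=> t Ut; rewrite (ext_vel E Ut).
move: n; apply/(times_derivableP _ (ext_open E)) => n t Ut.
by rewrite -derive1Sn; exact: ext_smooth E _ _ Ut.
Qed.

Lemma coincide_of_reparametrization (phi theta : R -> R) :
  cancel phi theta -> cancel theta phi ->
  (forall t : R, is_derive t 1 phi (enorm (Q2 t) / enorm (Q1 (phi t)))) ->
  (forall t : R, is_derive t 1 theta (enorm (Q1 t) / enorm (Q2 (theta t)))) ->
  (forall t, params M t -> params M (phi t) /\ P1 (phi t) = P2 t) ->
  (forall t, params M t -> params M (theta t)) ->
  (M = circle -> forall t, phi (t + 2 * pi) = phi t + 2 * pi /\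
                           theta (t + 2 * pi) = theta t + 2 * pi) ->
  coincide_mod_diffeo_plus M c1 c2.
Proof.
move=> phiK thetaK dphi dtheta phiM thetaM per.
have n1 t : enorm (Q1 t) != 0 by rewrite gt_eqF// enorm_gt0//; exact: ext_vel_neq0 E1 t.
have n2 t : enorm (Q2 t) != 0 by rewrite gt_eqF// enorm_gt0//; exact: ext_vel_neq0 E2 t.
have sphi : smooth_on (params M) phi.
  apply: (smooth_change_of_speed (ext_open E1) (ext_open E2) n1 (smooth_speed E1)
    (smooth_speed E2) dphi (ext_params E2)) => t /phiM[Mt _]; exact: (ext_params E1).
have stheta : smooth_on (params M) theta.
  apply: (smooth_change_of_speed (ext_open E2) (ext_open E1) n2 (smooth_speed E2)
    (smooth_speed E1) dtheta (ext_params E1)) => t /thetaM; exact: (ext_params E2).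
exists phi.
  split; last first.
    move=> t _; rewrite derive1E; have [_ ->] := dphi t.
    by rewrite divr_gt0// lt_neqAle eq_sym ?n1 ?n2 enorm_ge0.
  split.
    split => //; move: phiM per; case: M => phiM per t.
      by exists 1; rewrite mulr1; have [] := per erefl t.
    by move=> /phiM[].
  exists theta => [|t _]; last by rewrite phiK thetaK.
  split => //; move: thetaM per; case: M => thetaM per t; last exact: thetaM.
  by exists 1; rewrite mulr1; have [] := per erefl t.
move=> t Mt; have [Mphi e] := phiM t Mt.
by rewrite -(ext_pos E1 (ext_params E1 Mphi)) e (ext_pos E2 (ext_params E2 Mt)).
Qed.

End Reparametrization.

Section MatchedSegments.
Context (R : realType) (d : nat).
Context (c1 c2 P1 P2 Q1 Q2 : R -> 'rV[R]_d) (U1 U2 : set R).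
Hypothesis E1 : regular_extension segment c1 P1 Q1 U1.
Hypothesis E2 : regular_extension segment c2 P2 Q2 U2.
Hypothesis T1 : finite_transverse_self_intersections segment c1.
Hypothesis T2 : finite_transverse_self_intersections segment c2.
Hypothesis match12 : forall s : R, 0 <= s <= 2 * pi ->
  exists2 t, 0 <= t <= 2 * pi & matched P1 P2 Q1 Q2 s t.
Hypothesis match21 : forall s : R, 0 <= s <= 2 * pi ->
  exists2 t, 0 <= t <= 2 * pi & matched P2 P1 Q2 Q1 s t.

Lemma coincide_segment : coincide_mod_diffeo_plus segment c1 c2.
Proof.
have segI (t : R) : params segment t <-> 0 <= t <= 2 * pi by rewrite /= in_itv.
have ooI (s : R) : 0 < s < 2 * pi -> 0 <= s <= 2 * pi by move=> /andP[/ltW-> /ltW->].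
have dP c P Q U (E : regular_extension segment c P Q U) (t : R) :
    0 <= t <= 2 * pi -> is_derive t 1 P (Q t : 'rV[R]_d).
  by move=> /segI/(ext_params E); exact: ext_pos_derive E t.
have uniq c P Q U (P' Q' : R -> 'rV[R]_d) (E : regular_extension segment c P Q U) :
    finite_transverse_self_intersections segment c -> forall s t t' : R, 0 < s < 2 * pi ->
    0 <= t <= 2 * pi -> 0 <= t' <= 2 * pi -> matched P P' Q Q' s t ->
    matched P P' Q Q' s t' -> t = t'.
  move=> T s t t' _ /segI tI /segI t'I [Pt Qt] [Pt' Qt'].
  by apply: (points_inj E T) => //; [rewrite Pt|rewrite Qt].
have [phi [theta [K1 K2 dphi dtheta [phiI thetaI _]]]] := matched_reparametrization
  (ext_cont_vel E1) (ext_cont_vel E2) (ext_speed E1) (ext_speed E2) (dP _ _ _ _ E1)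
  (dP _ _ _ _ E2) (fun s sI => match12 (ooI s sI)) (fun s sI => match21 (ooI s sI))
  (uniq _ _ _ _ _ _ E1 T1) (uniq _ _ _ _ _ _ E2 T2).
by apply: (coincide_of_reparametrization E1 E2 K1 K2 dphi dtheta).
Qed.

End MatchedSegments.

Section MatchedCircles.
Context (R : realType) (d : nat).

Lemma is_derive_translate (P : R -> 'rV[R]_d) (q : 'rV[R]_d) (t b : R) :
  is_derive (t + b) 1 P q -> is_derive t 1 (fun s => P (s + b)) q.
Proof.
have e : (fun h : R => h^-1 *: (P (h *: 1 + t + b) - P (t + b))) =
    (fun h : R => h^-1 *: (P (h *: 1 + (t + b)) - P (t + b))).
  by apply/funext => h; rewrite addrA.
by move=> [dP Pq]; split; [rewrite /derivable /= e|rewrite /derive /= e].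
Qed.

Lemma interior_not_period (t : R) (k : int) : 0 < t < 2 * pi -> t <> 2 * pi * k%:~R.
Proof.
move=> tI te; have p0 := two_pi_gt0 R; have [k0|k1] := leP k 0.
  have : 2 * pi * k%:~R <= 0 :> R by rewrite pmulr_rle0// lerz0.
  lra.
have : 2 * pi * 1 <= 2 * pi * k%:~R :> R by rewrite ler_pM2l// ler1z -gtz0_ge1.
lra.
Qed.

(** Distinct congruent parameters in the closed period are 0 and 2 pi in some
    order; 0 is the one that its known match excludes in coincide_circle. *)
Lemma closed_period_congruent (s t : R) (k : int) : 0 <= s <= 2 * pi -> 0 <= t <= 2 * pi ->
  s = t + 2 * pi * k%:~R -> [\/ s = t, s = 0 | t = 0].
Proof.
move=> sI tI st; have p0 := two_pi_gt0 R; case: (ltgtP k 0) => [k0|k0|k0].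
- have : 2 * pi * k%:~R <= 2 * pi * (-1) :> R.
    by rewrite ler_pM2l// lerNr -mulrNz ler1z -gtz0_ge1 oppr_gt0.
  by move=> ?; apply: Or32; lra.
- have : 2 * pi * 1 <= 2 * pi * k%:~R :> R by rewrite ler_pM2l// ler1z -gtz0_ge1.
  by move=> ?; apply: Or33; lra.
- by apply: Or31; rewrite st k0 mulr0 addr0.
Qed.

Lemma circle_inj (c P Q : R -> 'rV[R]_d) U (E : regular_extension circle c P Q U) (s t : R) :
  finite_transverse_self_intersections circle c ->
  P s = P t -> direction (Q s) = direction (Q t) -> exists k : int, s = t + 2 * pi * k%:~R.
Proof.
move=> T Pst Qst.
have perP r : P (r + 2 * pi) = P r by have [] := ext_periodic E erefl r.
have perQ r : Q (r + 2 * pi) = Q r by have [] := ext_periodic E erefl r.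
have red r (k : int) : P (r - 2 * pi * k%:~R) = P r /\ Q (r - 2 * pi * k%:~R) = Q r.
  by rewrite -mulrN -mulrNz !periodic_int.
have [k kI] := period_reduce s; have [l lI] := period_reduce t.
have [Ps Qs] := red s k; have [Pt Qt] := red t l.
have e : s - 2 * pi * k%:~R = t - 2 * pi * l%:~R.
  apply: (points_inj E T); rewrite ?Ps ?Qs ?Pt ?Qt// /points/= in_itv//=.
exists (k - l); rewrite intrB.
by move: (k%:~R) (l%:~R) e => x y e; lra.
Qed.

Context (c1 c2 P1 P2 Q1 Q2 : R -> 'rV[R]_d) (U1 U2 : set R).
Hypothesis E1 : regular_extension circle c1 P1 Q1 U1.
Hypothesis E2 : regular_extension circle c2 P2 Q2 U2.
Hypothesis T1 : finite_transverse_self_intersections circle c1.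
Hypothesis T2 : finite_transverse_self_intersections circle c2.
Hypothesis match12 : forall s : R, 0 <= s <= 2 * pi ->
  exists2 t, 0 <= t <= 2 * pi & matched P1 P2 Q1 Q2 s t.
Hypothesis match21 : forall s : R, 0 <= s <= 2 * pi ->
  exists2 t, 0 <= t <= 2 * pi & matched P2 P1 Q2 Q1 s t.

(** Cutting the first circle at the match b of the parameter 0 turns the closed
    curves into arcs whose ends are matched with each other. *)
Lemma coincide_circle : coincide_mod_diffeo_plus circle c1 c2.
Proof.
have p0 := two_pi_gt0 R.
have [|b _ [Pb Qb]] := match12 (s := 0); first lra.
have perP c P Q U (E : regular_extension circle c P Q U) r : P (r + 2 * pi) = P r :> 'rV[R]_d.
  by have [] := ext_periodic E erefl r.
have perQ c P Q U (E : regular_extension circle c P Q U) r : Q (r + 2 * pi) = Q r :> 'rV[R]_d.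
  by have [] := ext_periodic E erefl r.
have UT (c P Q : R -> 'rV[R]_d) U (E : regular_extension circle c P Q U) (r : R) : U r.
  by have [] := ext_periodic E erefl r.
have ooI (s : R) : 0 < s < 2 * pi -> 0 <= s <= 2 * pi by move=> /andP[/ltW-> /ltW->].
have coI (s : R) : 0 <= s < 2 * pi -> 0 <= s <= 2 * pi by move=> /andP[-> /ltW->].
pose P1b t := P1 (t + b); pose Q1b t := Q1 (t + b).
have cQ1b : continuous Q1b.
  move=> t; apply: (@continuous_comp _ _ _ (fun t => t + b) Q1).
    by apply: cvgD; [exact: cvg_id|exact: cvg_cst].
  exact: ext_cont_vel E1 _.
have speed1b : exists2 m, 0 < m & forall t, m <= enorm (Q1b t).
  by have [m m0 mQ] := ext_speed E1; exists m => // t; exact: mQ.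
have dP1b (t : R) : 0 <= t <= 2 * pi -> is_derive t 1 P1b (Q1b t).
  by move=> _; exact: (is_derive_translate (ext_pos_derive E1 (UT _ _ _ _ E1 (t + b)))).
have dP2 (t : R) : 0 <= t <= 2 * pi -> is_derive t 1 P2 (Q2 t).
  by move=> _; exact: (ext_pos_derive E2 (UT _ _ _ _ E2 t)).
have ex12 (s : R) : 0 < s < 2 * pi -> exists2 t, 0 <= t <= 2 * pi & matched P1b P2 Q1b Q2 s t.
  move=> /ooI/match12[t _ [Pt Qt]]; have [k kI] := period_reduce (t - b).
  exists (t - b - 2 * pi * k%:~R); first exact: coI.
  rewrite /matched /P1b /Q1b -(periodic_int (perP _ _ _ _ E1) k)
    -(periodic_int (perQ _ _ _ _ E1) k).
  by rewrite addrAC subrK subrK.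
have ex21 (t : R) : 0 < t < 2 * pi -> exists2 s, 0 <= s <= 2 * pi & matched P2 P1b Q2 Q1b t s.
  move=> tI; have [k kI] := period_reduce (t + b).
  have [s sI [Ps Qs]] := match21 (coI _ kI); exists s => //.
  rewrite /matched Ps Qs /P1b /Q1b.
  by rewrite -mulrN -mulrNz (periodic_int (perP _ _ _ _ E1)) (periodic_int (perQ _ _ _ _ E1)).
have not0 (s : R) : 0 < s < 2 * pi -> ~ matched P1b P2 Q1b Q2 s 0.
  move=> sI [Ps Qs]; have [||k] := @circle_inj _ _ _ _ E2 s 0 T2.
  - by rewrite -Ps -Pb /P1b add0r.
  - by rewrite -Qs -Qb /Q1b add0r.
  by rewrite add0r; exact: interior_not_period.
have not0' (t : R) : 0 < t < 2 * pi -> ~ matched P2 P1b Q2 Q1b t 0.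
  move=> tI [Ps Qs]; have [||k] := @circle_inj _ _ _ _ E1 (t + b) b T1.
  - by rewrite -[LHS]Ps Pb.
  - by rewrite -[LHS]Qs Qb.
  by rewrite addrC => /addrI; exact: interior_not_period.
have un12 (s t t' : R) : 0 < s < 2 * pi -> 0 <= t <= 2 * pi -> 0 <= t' <= 2 * pi ->
    matched P1b P2 Q1b Q2 s t -> matched P1b P2 Q1b Q2 s t' -> t = t'.
  move=> sI tI t'I m m'; have [||k] := @circle_inj _ _ _ _ E1 (t + b) (t' + b) T1.
  - by rewrite [LHS]m.1 [RHS]m'.1.
  - by rewrite [LHS]m.2 [RHS]m'.2.
  rewrite addrAC => /addIr e; have [//|t0|t0] := closed_period_congruent tI t'I e; exfalso.
    by apply: (not0 s sI); rewrite -t0.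
  by apply: (not0 s sI); rewrite -t0.
have un21 (t s s' : R) : 0 < t < 2 * pi -> 0 <= s <= 2 * pi -> 0 <= s' <= 2 * pi ->
    matched P2 P1b Q2 Q1b t s -> matched P2 P1b Q2 Q1b t s' -> s = s'.
  move=> tI sI s'I m m'; have [||k e] := @circle_inj _ _ _ _ E2 s s' T2.
  - by rewrite m.1 m'.1.
  - by rewrite m.2 m'.2.
  have [//|s0|s0] := closed_period_congruent sI s'I e; exfalso.
    by apply: (not0' t tI); rewrite -s0.
  by apply: (not0' t tI); rewrite -s0.
have [phi [theta [K1 K2 dphi dtheta [phiI _ per]]]] := matched_reparametrization
  cQ1b (ext_cont_vel E2) speed1b (ext_speed E2) dP1b dP2 ex12 ex21 un12 un21.
have {}per : forall t, phi (t + 2 * pi) = phi t + 2 * pi /\ theta (t + 2 * pi) = theta t + 2 * pi.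
  apply: per => t; last exact: perQ E2 t.
  by rewrite /Q1b addrAC; exact: perQ E1 _.
have P12 (t : R) : P1b (phi t) = P2 t.
  have [k kI] := period_reduce t; set t0 := t - 2 * pi * k%:~R in kI.
  have per12 r : P1b (phi (r + 2 * pi)) = P1b (phi r).
    by rewrite (per r).1 /P1b addrAC; exact: perP E1 _.
  have -> : t = t0 + 2 * pi * k%:~R by rewrite subrK.
  rewrite (periodic_int (perP _ _ _ _ E2)).
  rewrite (periodic_int (f := fun r => P1b (phi r)) per12 k t0).
  by have [_ ->] := phiI _ (coI _ kI).
apply: (@coincide_of_reparametrization _ _ _ _ _ _ _ _ _ _ _ E1 E2
  (fun t => phi t + b) (fun t => theta (t - b))).
- by move=> t; rewrite addrK K1.
- by move=> t; rewrite K2 subrK.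
- move=> t; rewrite -[X in is_derive _ _ _ X]addr0.
  exact: is_deriveD (dphi t) (is_derive_cst b t 1).
- move=> t; have d1 : is_derive t 1 (fun s : R => s - b) (1 - 0).
    exact: is_deriveB (is_derive_id t 1) (is_derive_cst b t 1).
  have := @is_derive1_comp _ theta (fun s => s - b) t _ _ (dtheta (t - b)) d1.
  by rewrite subr0 mulr1 /Q1b subrK.
- by move=> t _; split => //; exact: P12.
- by [].
- move=> _ t; rewrite (per t).1 addrAC; split => //.
  by rewrite addrAC (per (t - b)).2.
Qed.

End MatchedCircles.

(** * Invariance of the varifold under changes of parameter *)

Section Invariance.
Context (R : realType) (d : nat) (M : manifold1).

Lemma is_derive_comp_curve (c : R -> 'rV[R]_d) (phi : R -> R) (q : 'rV[R]_d) (a t : R) :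
  is_derive (phi t) 1 c q -> is_derive t 1 phi a ->
  is_derive t 1 (fun s => c (phi s)) (a *: q).
Proof.
move=> [dc <-] dphi.
have dci i j : is_derive t 1 (fun s => c (phi s) i j) ('D_1 (fun s => c s i j) (phi t) * a).
  apply: (@is_derive1_comp _ (fun s => c s i j) phi) => //.
  by apply: derivableP; exact: (derivable_mxP _ _ _).1.
have dcphi : derivable (fun s => c (phi s)) t 1.
  by apply/derivable_mxP => i j; have [] := dci i j.
split; first exact: dcphi.
rewrite (derive_mx dcphi) (derive_mx dc); apply/matrixP => i j.
by rewrite !mxE mulrC; have [_] := dci i j.
Qed.

Lemma params_convex (s t x : R) : params M s -> params M t -> s <= x <= t -> params M x.
Proof. by case: M => //=; rewrite !in_itv/= => sI tI xI; lra. Qed.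

Lemma diffeo_plus_derive (phi : R -> R) (t : R) : diffeo_plus M phi -> params M t ->
  is_derive t 1 phi (phi^`() t).
Proof.
move=> [[[[U [_ MU dU]] _] _] _] Mt; rewrite derive1E; apply: derivableP.
exact: (dU 0%N t (MU t Mt)).
Qed.

Lemma diffeo_plus_increasing (phi : R -> R) (s t : R) : diffeo_plus M phi ->
  params M s -> params M t -> s < t -> phi s < phi t.
Proof.
move=> D Ms Mt st; have dphi x : s <= x <= t -> is_derive x 1 phi (phi^`() x).
  by move=> /(params_convex Ms Mt); exact: diffeo_plus_derive.
have [||x] := @MVT R phi phi^`() s t st.
- by move=> x; rewrite in_itv/= => /andP[/ltW sx /ltW xt]; apply: dphi; rewrite sx.
- apply: continuous_in_subspaceT => x; rewrite inE/= in_itv/= => xI.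
  exact: is_derive_continuous (dphi x xI).
rewrite in_itv/= => /andP[/ltW sx /ltW xt] e.
rewrite -subr_gt0 e mulr_gt0 ?subr_gt0//; apply: D.2.
by apply: (params_convex Ms Mt); rewrite sx.
Qed.

Lemma diffeo_plus_params (phi : R -> R) (t : R) : diffeo_plus M phi -> params M t ->
  params M (phi t).
Proof. by move=> [[[_ +] _] _]; case: M => // H Mt; exact: H. Qed.

(** The lift of a diffeomorphism of the circle advances by exactly one turn: by
    more, it would reach phi 0 + 2 pi at an interior point of the period, while
    its inverse maps phi 0 + 2 pi to a multiple of 2 pi.  On the segment, a
    diffeomorphism that increases fixes the ends. *)
Lemma diffeo_plus_turn (phi F g : R -> R) : diffeo_plus M phi ->
  (forall t : R, is_derive t 1 F (g t)) -> (M = circle -> forall t, g (t + 2 * pi) = g t) ->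
  F (phi (2 * pi)) - F (phi 0) = F (2 * pi) - F 0.
Proof.
move=> D dF per; have p0 := two_pi_gt0 R.
have inc := diffeo_plus_increasing D; have Mphi := diffeo_plus_params D.
have [[[_ turn] [psi [_ psiM] K]] _] := D.
case: M turn psiM K per inc Mphi => turn psiM K per inc Mphi.
- have [k kE] := turn 0; rewrite add0r in kE.
  have k1 : k = 1.
    have k0 : (0 < k)%R.
      have : phi 0 < phi (2 * pi) by apply: inc.
      by rewrite kE ltrDl pmulr_rgt0// ltr0z.
    apply/eqP; rewrite eq_le -gtz0_ge1 k0 andbT leNgt; apply/negP => k1.
    have [l lE] := psiM (phi 0); rewrite (K 0 I).1 add0r in lE.
    have phis : phi (2 * pi * l%:~R) = phi 0 + 2 * pi by rewrite -lE (K _ I).2.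
    have incE s t : (phi s < phi t) -> s < t.
      move=> st; rewrite ltNge le_eqVlt; apply/negP => /predU1P[ts|/(inc _ _ I I) ts].
        by rewrite ts ltxx in st.
      by have := lt_trans st ts; rewrite ltxx.
    have : 0 < (2 * pi * l%:~R : R) < 2 * pi.
      apply/andP; split; apply: incE; rewrite phis; first by rewrite ltrDl.
      by rewrite kE ltrD2l -[ltLHS]mulr1 ltr_pM2l// ltr1z.
    by move=> /interior_not_period; apply.
  rewrite kE k1 mulr1.
  by have e := arc_length_periodic dF (per erefl) (phi 0); rewrite e; ring.
have segI (t : R) : 0 <= t <= 2 * pi -> params segment t by rewrite /= in_itv.
have s0 : params segment (0 : R) by apply: segI; lra.
have s1 : params segment (2 * pi : R) by apply: segI; lra.
have le s t : params segment s -> params segment t -> s <= t -> phi s <= phi t.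
  by move=> Ms Mt; rewrite le_eqVlt => /predU1P[->//|/(inc _ _ Ms Mt)/ltW].
have in_seg (t : R) : params segment t -> 0 <= t <= 2 * pi by rewrite /= in_itv.
have phi0 : phi 0 = 0.
  have /andP[a _] := in_seg _ (Mphi _ s0); have /andP[b _] := in_seg _ (psiM _ s0).
  by have := le _ _ s0 (psiM _ s0) b; rewrite (K 0 s0).2; lra.
have phi1 : phi (2 * pi) = 2 * pi.
  have /andP[_ a] := in_seg _ (Mphi _ s1); have /andP[_ b] := in_seg _ (psiM _ s1).
  by have := le _ _ (psiM _ s1) s1 b; rewrite (K _ s1).2; lra.
by rewrite phi0 phi1.
Qed.

Context (c1 c2 P1 P2 Q1 Q2 : R -> 'rV[R]_d) (U1 U2 : set R).
Hypothesis E1 : regular_extension M c1 P1 Q1 U1.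
Hypothesis E2 : regular_extension M c2 P2 Q2 U2.

Lemma varifold_reparametrization (w : phase R d -> R) : continuous w ->
  coincide_mod_diffeo_plus M c1 c2 -> varifold M c1 w = varifold M c2 w.
Proof.
move=> cw [phi D e]; have p0 := two_pi_gt0 R.
have cws c P Q U (E : regular_extension M c P Q U) :
    continuous (fun t => w (P t, sphere_direction E t)).
  move=> t; apply: (@continuous_comp _ _ _ (fun t => (P t, sphere_direction E t)) w).
    exact: (cvg_pair (ext_cont_pos E t) (continuous_sphere_direction E t)).
  exact: cw.
pose G c P Q U (E : regular_extension M c P Q U) t :=
  w (P t, sphere_direction E t) * enorm (Q t).
have cG c P Q U (E : regular_extension M c P Q U) : continuous (G _ _ _ _ E).
  by move=> t; apply: cvgM; [exact: cws|exact: continuous_speed E t].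
rewrite (varifoldE (@cws _ _ _ _ E1)) (varifoldE (@cws _ _ _ _ E2)).
have [F [_ dF]] := primitive_exists (@cG _ _ _ _ E1).
have cF t := is_derive_continuous (dF t).
have cphi (t : R) : 0 <= t <= 2 * pi -> {for t, continuous phi}.
  by move=> /(params_period M)/(diffeo_plus_derive D); exact: is_derive_continuous.
have cFphi (t : R) : 0 <= t <= 2 * pi -> {for t, continuous (F \o phi)}.
  by move=> tI; apply: continuous_comp; [exact: cphi|exact: cF].
have -> : period_integral (G _ _ _ _ E1) = F (2 * pi) - F 0.
  by apply: integral_primitive => //; exact: cF.
have -> : period_integral (G _ _ _ _ E2) = F (phi (2 * pi)) - F (phi 0).
  apply: (integral_primitive (F := F \o phi) p0 (@cG _ _ _ _ E2)); last 2 first.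
  - by apply: (cFphi 0); lra.
  - by apply: (cFphi (2 * pi)); lra.
  move=> t tI; have tK : 0 <= t <= 2 * pi by move: tI => /andP[/ltW-> /ltW->].
  have Mt := params_period M tK; have Mphit := diffeo_plus_params D Mt.
  have dphi := diffeo_plus_derive D Mt; have phi'0 := D.2 t Mt.
  have U1t := ext_params E1 Mphit; have U2t := ext_params E2 Mt.
  have c2phi : \forall s \near t, c1 (phi s) = c2 s.
    move/andP: tI => [t0 t1].
    near=> s; apply/esym/e/params_period/andP; split; apply: ltW; near: s.
      exact: lt_nbhsr.
    exact: lt_nbhsl.
  have Q2E : Q2 t = derive1 phi t *: Q1 (phi t).
    have [_ <-] := ext_derive E2 U2t.
    have d2 := is_derive_comp_curve (ext_derive E1 U1t) dphi.
    by have [_ ->] := near_eq_is_derive c2phi d2.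
  have P2E : P2 t = P1 (phi t) by rewrite (ext_pos E2 U2t) (ext_pos E1 U1t) (e t Mt).
  have -> : G _ _ _ _ E2 t = G _ _ _ _ E1 (phi t) * derive1 phi t.
    have sE : sphere_direction E2 t = sphere_direction E1 (phi t).
      by apply: val_inj => /=; rewrite Q2E directionZ.
    by rewrite /G sE P2E Q2E enormZ gtr0_norm//; ring.
  exact: is_derive1_comp (dF (phi t)) dphi.
apply/esym; apply: (diffeo_plus_turn D dF) => Mc t.
have [_ Pt Qt] := ext_periodic E1 Mc t.
have sE : sphere_direction E1 (t + 2 * pi) = sphere_direction E1 t.
  by apply: val_inj => /=; rewrite Qt.
by rewrite /G sE Pt Qt.
Unshelve. all: by end_near. Qed.

End Invariance.

Theorem theorem3p6 (R : realType) (d : nat) (M : manifold1)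
    (rho gamma : R -> R) (H : rkhs (@varifold_kernel R d rho gamma))
    (c1 c2 : R -> 'rV[R]_d) :
  (2 <= d)%N ->
  radial_basis_function d rho ->
  zonal_function d gamma ->
  positive_definite (@varifold_kernel R d rho gamma) ->
  embedded_in_C0 H ->
  C1_on `[0, +oo[ rho ->
  C1_on `[(-1), 1] gamma ->
  C0_universal d rho ->
  0 < gamma 1 ->
  (forall t, -1 <= t <= 1 -> t <> 0 -> gamma (- t) <> gamma t) ->
  immersion M c1 -> finite_transverse_self_intersections M c1 ->
  immersion M c2 -> finite_transverse_self_intersections M c2 ->
  dVar H M c1 c2 = 0%E <-> coincide_mod_diffeo_plus M c1 c2.
Proof.
move=> _ _ _ _ [HC0 _] rhoC1 gammaC1 univ gamma1 gamma_odd I1 T1 I2 T2.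
have [P1 [Q1 [U1 E1]]] := immersion_extension I1.
have [P2 [Q2 [U2 E2]]] := immersion_extension I2.
split=> [D0|coincide].
  have test u f (u1 : enorm u = 1) (Cf : C0 f) :=
    dVar0_test_function rhoC1 gammaC1 E1 E2 univ D0 u1 Cf.
  have match12 := match_exists gammaC1 gamma1 gamma_odd E1 E2 T1 T2 test.
  have match21 := match_exists gammaC1 gamma1 gamma_odd E2 E1 T2 T1
    (fun u f u1 Cf => esym (test u f u1 Cf)).
  case: M T1 T2 E1 E2 match12 match21 {H HC0 I1 I2 D0 test} => T1 T2 E1 E2 match12 match21.
    exact: (coincide_circle E1 E2 T1 T2 match12 match21).
  exact: (coincide_segment E1 E2 T1 T2 match12 match21).
rewrite /dVar /rkhs_dual_norm.
rewrite (_ : [set _ | _ in _] = [set 0%E]) ?ereal_sup1//.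
apply/seteqP; split => [_ [w [Hw _] <-]|_ ->] /=.
  have cw := (HC0 w Hw).1.
  by rewrite (varifold_reparametrization E1 E2 cw coincide) subrr normr0.
have H0 := rkhs_space0 H; exists (fun=> 0); last first.
  have c0 := (HC0 _ H0).1.
  by rewrite (varifold_reparametrization E1 E2 c0 coincide) subrr normr0.
by split => //; rewrite /rkhs_norm rkhs_ip0l// sqrtr0.
Qed.
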